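(* Let $d\ge1$ and let $\mu\in\mathcal{P}(\mathbb{R}^d)\cap L^\infty(\mathbb{R}^d)$ be compactly supported. There exists a sequence $\rho_n\in C_c^\infty(\mathbb{R}^d)\cap\mathcal{P}(\mathbb{R}^d)$ such that $$\frac{\mathsf{D}(\rho_n\mid\mu)}{\mathrm{MMD}^2(\rho_n,\mu)}\longrightarrow0.$$ Consequently, there is no finite constant $C=C(d,\mu)$ such that $\mathrm{MMD}^2(\rho,\mu)\le C\,\mathsf{D}(\rho\mid\mu)$ for every smooth compactly supported probability density $\rho$.
   Context: $\mathcal{P}(\mathbb{R}^d)$ is the set of Borel probability measures, identified with densities when absolutely continuous. $g$ is the Coulomb kernel on $\mathbb{R}^d$: $g(x)=-\frac12|x|$ for $d=1$, $g(x)=-\frac1{2\pi}\log|x|$ for $d=2$, $g(x)=\frac1{(d-2)\sigma_d}|x|^{2-d}$ for $d\ge3$, $\sigma_d=|\mathbb{S}^{d-1}|$. $\mathrm{MMD}^2(\rho,\mu):=\frac12\int g*(\rho-\mu)\,d(\rho-\mu)$ and $\mathsf{D}(\rho\mid\mu):=\int|\nabla g*(\rho-\mu)|^2\,d\rho$. *)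

(* Defs.v *)
From HB Require Import structures.
From mathcomp Require Import all_boot all_order all_algebra.
From mathcomp Require Import all_classical all_reals all_analysis.
From mathcomp Require Import measurable_realfun.

Set Implicit Arguments.
Unset Strict Implicit.
Unset Printing Implicit Defensive.

Import Order.TTheory GRing.Theory Num.Theory.
Import numFieldNormedType.Exports.

Local Open Scope classical_set_scope.
Local Open Scope ring_scope.

(* R^d is 'rV[R]_d; [borel R d] is the same type equipped with its Borel
   sigma-algebra, the one generated by the open sets. *)
Notation borel R d := (g_sigma_algebraType (@open 'rV[R]_d)).

(* Lebesgue measure on R^d is the d-fold product of the one-dimensional Lebesgue
   measure. It is built on tuples, by taking products on the left, and then
   transported to row vectors; [lebesgue_rV_box] computes it on boxes. *)
Section product_lebesgue.
Context {R : realType}.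
Local Notation mR := (measurableTypeR R).
Local Open Scope ereal_scope.

Definition cons_pair n (p : mR * n.-tuple mR) : n.+1.-tuple mR :=
  [tuple of p.1 :: p.2].

Lemma measurable_cons_pair n : measurable_fun setT (@cons_pair n).
Proof. exact: measurable_cons. Qed.

Section cons_measure.
Variables (n : nat) (m : {sigma_finite_measure set (n.-tuple mR) -> \bar R}).

Definition cons_measure : set (n.+1.-tuple mR) -> \bar R :=
  pushforward (lebesgue_measure \x m) (@cons_pair n).

Let mcons0 : cons_measure set0 = 0.
Proof. by rewrite /cons_measure /pushforward preimage_set0 measure0. Qed.

Let mcons_ge0 A : 0 <= cons_measure A.
Proof. by rewrite /cons_measure /pushforward measure_ge0. Qed.

Let mcons_sigma_additive : semi_sigma_additive cons_measure.
Proof.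
have mc := @measurable_cons_pair n.
move=> F mF tF mUF; rewrite /cons_measure /pushforward preimage_bigcup.
apply: measure_semi_sigma_additive.
- by move=> k; rewrite -[X in measurable X]setTI; exact: mc.
- apply/trivIsetP => /= i j _ _ ij; rewrite -preimage_setI.
  by move/trivIsetP : tF => /(_ _ _ _ _ ij) ->//; rewrite preimage_set0.
- by rewrite -preimage_bigcup -[X in measurable X]setTI; exact: mc.
Qed.

HB.instance Definition _ := isMeasure.Build _ _ _
  cons_measure mcons0 mcons_ge0 mcons_sigma_additive.

Let mcons_sigma_finite : sigma_finite setT cons_measure.
Proof.
pose split (t : n.+1.-tuple mR) : mR * n.-tuple mR :=
  (thead t, [tuple of behead t]).
have msplit : measurable_fun setT split.
  by apply: measurable_fun_pair; [exact: measurable_tnth|exact: measurable_behead].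
have /sigma_finiteP[F [TF ndF Foo]] := sigma_finiteT (@lebesgue_measure R).
have /sigma_finiteP[G [TG ndG Goo]] := sigma_finiteT m.
exists (fun k => split @^-1` (F k `*` G k)).
  rewrite -preimage_bigcup; apply/esym/seteqP; split=> // t _.
  have [i _ Fi] : (\bigcup_i F i) (split t).1 by rewrite -TF.
  have [j _ Gj] : (\bigcup_i G i) (split t).2 by rewrite -TG.
  exists (maxn i j) => //; split.
  - exact: (subsetPset _ _ (ndF _ _ (leq_maxl i j))) Fi.
  - exact: (subsetPset _ _ (ndG _ _ (leq_maxr i j))) Gj.
move=> k; have [mF Fk] := Foo k; have [mG Gk] := Goo k; split.
  by rewrite -[X in measurable X]setTI; apply: msplit => //; exact: measurableX.
rewrite /cons_measure /pushforward -comp_preimage.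
rewrite (_ : split \o @cons_pair n = id) ?preimage_id.
  by rewrite product_measure1E// lte_mul_pinfty// ge0_fin_numE.
apply/funext => -[x t]; rewrite /split /cons_pair /=; congr pair.
exact: val_inj.
Qed.

HB.instance Definition _ := Measure_isSigmaFinite.Build _ _ _
  cons_measure mcons_sigma_finite.

End cons_measure.

Fixpoint lebesgue_tuple n : {sigma_finite_measure set (n.-tuple mR) -> \bar R} :=
  match n with
  | 0 => \d_([tuple] : 0.-tuple mR)
  | n'.+1 => cons_measure (lebesgue_tuple n')
  end.

Definition row_of_tuple d (t : d.-tuple mR) : borel R d :=
  (\row_(i < d) tnth t i)%R.

Lemma measurable_row_of_tuple d : measurable_fun setT (@row_of_tuple d).
Proof.
apply: (@measurability _ _ _ (borel R d) _ _ (@open 'rV[R]_d)) => //.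
move=> _ [U oU <-]; rewrite setTI.
pose B (p : 'rV[rat]_d * nat) : set 'rV[R]_d :=
  [set v | forall i, `|v ord0 i - ratr (p.1 ord0 i)| < p.2.+1%:R^-1]%R.
have mB p : measurable (@row_of_tuple d @^-1` B p).
  rewrite (_ : _ @^-1` _ = \bigcap_(i in [set: 'I_d])
      ((fun t : d.-tuple mR => tnth t i) @^-1`
        ball (ratr (p.1 ord0 i) : R) p.2.+1%:R^-1%R)); last first.
    apply/seteqP; split => t /= tB i; first move=> _.
      by have := tB i; rewrite mxE /ball/= distrC.
    by have := tB i I; rewrite mxE /ball/= distrC.
  apply: fin_bigcap_measurable => // i _.
  rewrite -[X in measurable X]setTI; apply: measurable_tnth => //.
  exact: measurable_ball.
rewrite (_ : U = \bigcup_(p in [set p | B p `<=` U]) B p); last first.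
  apply/seteqP; split => [v Uv|v [p /= + Bv]]; last exact.
  have /nbhs_ballP[e /= e0 veU] : nbhs v U by exact: open_nbhs_nbhs.
  pose k := Num.trunc (e^-1 * 2)%R.
  have ke : (k.+1%:R^-1 < e / 2)%R.
    rewrite invf_plt ?posrE// ?divr_gt0// invf_div mulrC.
    exact: truncnS_gt.
  have rq i : exists q : rat, (`|v ord0 i - ratr q| < k.+1%:R^-1)%R.
    have [|q] := @rat_in_itvoo R (v ord0 i - k.+1%:R^-1)%R
      (v ord0 i + k.+1%:R^-1)%R.
      by rewrite ltrD2l (@lt_trans _ _ 0%R)// ?oppr_lt0 invr_gt0.
    rewrite in_itv/= => /andP[q1 q2]; exists q.
    by rewrite distrC ltr_distl q1 q2.
  have [q qP] := choice rq.
  exists ((\row_i q i)%R, k) => /=; last by move=> i; rewrite mxE.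
  move=> w Bw; apply: veU; split=> // i j; rewrite ord1.
  rewrite /ball/= (le_lt_trans (ler_distD (ratr (q j)) _ _))//.
  rewrite (splitr e) ltrD// (lt_trans _ ke)//.
  by rewrite distrC; have := Bw j; rewrite mxE.
rewrite preimage_bigcup bigcup_mkcond.
apply: countable_bigcupT_measurable => [|p]; last by case: ifPn.
exact: countableP.
Qed.

Definition lebesgue_rV d : set (borel R d) -> \bar R :=
  pushforward (lebesgue_tuple d) (@row_of_tuple d).

Section lebesgue_rV_measure.
Variable d : nat.

Let lebesgue_rV0 : lebesgue_rV (set0 : set (borel R d)) = 0.
Proof. by rewrite /lebesgue_rV /pushforward preimage_set0 measure0. Qed.

Let lebesgue_rV_ge0 (A : set (borel R d)) : 0 <= lebesgue_rV A.
Proof. by rewrite /lebesgue_rV /pushforward measure_ge0. Qed.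

Let lebesgue_rV_sigma_additive : semi_sigma_additive (@lebesgue_rV d).
Proof.
have mr := @measurable_row_of_tuple d.
move=> F mF tF mUF; rewrite /lebesgue_rV /pushforward preimage_bigcup.
apply: measure_semi_sigma_additive.
- by move=> k; rewrite -[X in measurable X]setTI; exact: mr.
- apply/trivIsetP => /= i j _ _ ij; rewrite -preimage_setI.
  by move/trivIsetP : tF => /(_ _ _ _ _ ij) ->//; rewrite preimage_set0.
- by rewrite -preimage_bigcup -[X in measurable X]setTI; exact: mr.
Qed.

HB.instance Definition _ := isMeasure.Build _ _ _ (@lebesgue_rV d)
  lebesgue_rV0 lebesgue_rV_ge0 lebesgue_rV_sigma_additive.

End lebesgue_rV_measure.

Lemma lebesgue_tuple_box n (A : 'I_n -> set mR) :
  (forall i, measurable (A i)) ->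
  measurable [set t : n.-tuple mR | forall i, A i (tnth t i)] /\
  lebesgue_tuple n [set t | forall i, A i (tnth t i)] =
    \prod_(i < n) lebesgue_measure (A i).
Proof.
elim: n A => [|n IH] A mA; have mB : measurable
    [set t : _.-tuple mR | forall i, A i (tnth t i)].
- rewrite (_ : [set _ | _] = setT)//; apply/seteqP; split=> // t _ [].
  by [].
- split=> //; rewrite big_ord0 /= diracE mem_set//= => -[].
  by [].
- rewrite (_ : [set _ | _] = \bigcap_(i in [set: 'I_n.+1])
      ((fun t : n.+1.-tuple mR => tnth t i) @^-1` A i)).
    apply: fin_bigcap_measurable => // i _.
    by rewrite -[X in measurable X]setTI; exact: measurable_tnth.
  by apply/seteqP; split=> t /= tA i => [_|]; exact: tA.
- split=> //; rewrite big_ord_recl /=.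
  have [mA' IHA] := IH (fun i => A (lift ord0 i)) (fun i => mA _).
  rewrite /cons_measure /pushforward -IHA -product_measure1E//.
  congr (_ _); apply/seteqP; split=> -[x t] /= xtA.
    split; first by have := xtA ord0.
    by move=> i; have := xtA (lift ord0 i); rewrite tnthS.
  move=> i; case: (unliftP ord0 i) => [j ->|->]; last exact: xtA.1.
  by rewrite tnthS; exact: xtA.2.
Qed.

Lemma lebesgue_rV_box d (A : 'I_d -> set mR) :
  (forall i, measurable (A i)) ->
  lebesgue_rV [set x : borel R d | forall i, A i ((x : 'rV[R]_d) ord0 i)] =
    \prod_(i < d) lebesgue_measure (A i).
Proof.
move=> /lebesgue_tuple_box[_ <-]; rewrite /lebesgue_rV /pushforward.
by congr (_ _); apply/seteqP; split=> t /= tA i; have := tA i; rewrite mxE.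
Qed.

End product_lebesgue.

Section coulomb.
Context {R : realType} {d : nat}.
Implicit Types (f : 'rV[R]_d -> R) (x y : 'rV[R]_d).
Implicit Types rho mu : probability (borel R d) R.

(* The norm that the library puts on 'rV[R]_d is the sup norm, hence this. *)
Definition enorm x : R := Num.sqrt (\sum_(i < d) x ord0 i ^+ 2).

Definition partial (i : 'I_d) f : 'rV[R]_d -> R :=
  fun x => 'D_(delta_mx ord0 i) f x.

Definition grad f x : 'rV[R]_d := \row_(i < d) partial i f x.

Fixpoint is_Ck (k : nat) f : Prop :=
  continuous f /\
  if k is k'.+1 then
    forall i : 'I_d, (forall x, derivable f x (delta_mx ord0 i)) /\
                     is_Ck k' (partial i f)
  else True.

Definition smooth f : Prop := forall k, is_Ck k f.

Definition Cc_infty f : Prop :=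
  smooth f /\ compact (closure [set x | f x != 0]).

Definition has_density mu f : Prop :=
  forall A : set (borel R d), measurable A ->
    mu A = (\int[lebesgue_rV (d:=d)]_(x in A) (f x)%:E)%E.

Definition Linfty_density mu : Prop :=
  exists2 f : borel R d -> R,
    f \in Lfun (lebesgue_rV (d:=d)) +oo%E & has_density mu f.

Definition Cc_infty_density rho : Prop :=
  exists2 f : 'rV[R]_d -> R, Cc_infty f & has_density rho f.

Definition compactly_supported mu : Prop :=
  exists2 K : set 'rV[R]_d, compact K & mu (~` K) = 0%E.

(* The surface measure in polar coordinates: d times the volume of the cone
   over A. *)
Definition surface_measure (A : set 'rV[R]_d) : \bar R :=
  (d%:R%:E * lebesgue_rV
    [set x : borel R d | exists r : R, exists2 u : 'rV[R]_d,
       A u & (0 < r <= 1)%R /\ x = (r *: u)%R])%E.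

Definition sphere_area : R :=
  fine (surface_measure [set u | enorm u = 1]).

(* For d >= 2 the value of g at the origin, here 0 because of the conventions
   ln 0 = 0 and 0^-1 = 0, is irrelevant: all the measures below have densities,
   so that points are negligible. The case d = 0 is junk. *)
Definition coulomb x : R :=
  match d with
  | 0 => 0
  | 1 => - (2^-1 * enorm x)
  | 2 => - ((2 * pi)^-1 * ln (enorm x))
  | _ => ((d - 2)%N%:R * sphere_area)^-1 * enorm x ^- (d - 2)
  end.

(* g * mu *)
Definition potential mu x : R :=
  (\int[mu]_(y in [set: borel R d]) coulomb (x - (y : 'rV[R]_d)))%R.

(* g * (rho - mu) *)
Definition potential_diff rho mu x : R := potential rho x - potential mu x.

(* Integrals against the signed measure rho - mu are differences of integrals.
   For bounded, compactly supported densities, all of them converge absolutely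
   and [potential_diff] is continuously differentiable. *)
Definition MMD2 rho mu : R :=
  2^-1 * ((\int[rho]_(x in [set: borel R d]) potential_diff rho mu x)%R -
          (\int[mu]_(x in [set: borel R d]) potential_diff rho mu x)%R).

Definition dissipation rho mu : \bar R :=
  (\int[rho]_(x in [set: borel R d])
     (enorm (grad (potential_diff rho mu) x) ^+ 2)%:E)%E.

End coulomb.

(* Main.v *)
Require Import Defs.
From HB Require Import structures.
From mathcomp Require Import all_boot all_order all_algebra.
From mathcomp Require Import all_classical all_reals all_analysis.
From mathcomp Require Import measurable_realfun ess_sup_inf ring lra.

Set Implicit Arguments.
Unset Strict Implicit.
Unset Printing Implicit Defensive.

Import Order.TTheory GRing.Theory Num.Theory.
Import numFieldNormedType.Exports.

Local Open Scope classical_set_scope.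
Local Open Scope ring_scope.

(** The dissipation only sees the field on the support of rho, whereas the energy
   sees it everywhere.  Hence a rho that is spread out over a huge region far away
   from mu costs almost no dissipation and keeps a sizeable distance to mu.

   Take for rho the normalized tensor product of dilated bumps, supported in a cube
   of side s all of whose coordinates lie between 3 s and 4 s, with a density of
   size at most C s^(-d) (spread_probability), and let s tend to infinity.  Write
   g(x) = G(|x|), where G is nonincreasing on the positive reals.

   Energy.  On the support of rho the potential of rho is at least G(diam rho) and
   that of mu at most G(dist), where dist is the distance of the two supports; on
   the support of mu the roles are exchanged.  Hence
   2 MMD^2 >= G(diam rho) + G(diam mu) - 2 G(dist)  (MMD2_ge),
   and with diam rho <= d s, dist >= 2 s, the right-hand side tends to infinity in
   dimensions 1 and 2 and to at least G(diam mu) > 0 in dimensions d >= 3.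

   Dissipation.  The mean value inequality
   |G(a) - G(b)| <= C |a - b| (a^(1-d) + b^(1-d))
   bounds the local Lipschitz constant of the potential of a measure nu by the
   Riesz potential of nu with kernel |x|^(1-d) (potential_lipschitz).  A sum over
   dyadic shells bounds the latter by r^(1-d) + C K r, for any r > 0, as soon as nu
   gives mass at most K t^d to each cube of half-side t <= r around the point
   (integral_riesz_le).  Near the support of rho, choose r = s: then K is of order
   s^(-d) for rho, and K = 0 for mu, which is far away.  So the field is of order
   s^(1-d) there, and the dissipation of order s^(2(1-d)) (spread_estimates).

   Dividing, the ratio tends to 0: in dimension 1 because the energy grows like s
   while the dissipation is bounded, and for d >= 2 because the dissipation tends
   to 0 while the energy is bounded below (energy_gap_dominates).  A bound
   MMD^2 <= C D would force the ratio to stay at least 1 / C. *)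

(** * A smooth bump on the line *)

Section smooth_1d.
Context {R : realType}.
Implicit Types (u v : R -> R) (k n : nat) (x a b c : R).

Fixpoint differentiable_upto k u : Prop :=
  (forall x, derivable u x 1) /\
  if k is k'.+1 then differentiable_upto k' u^`()%classic else True.

Definition smooth1 u := forall k, differentiable_upto k u.

Lemma differentiable_uptoW k u :
  differentiable_upto k.+1 u -> differentiable_upto k u.
Proof. by elim: k u => [|k IH] u [du du']; split; [exact: du|by []|exact: du|exact: IH]. Qed.

Lemma differentiable_uptoD k u v : differentiable_upto k u ->
  differentiable_upto k v -> differentiable_upto k (u \+ v).
Proof.
elim: k u v => [|k IH] u v [du du'] [dv dv'].
  by split=> [x|]; [exact: derivableD|].
split=> [x|]; first exact: derivableD.
rewrite (_ : (u \+ v)^`()%classic = u^`()%classic \+ v^`()%classic); first exact: IH.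
by apply/funext => x; rewrite /= !derive1E (deriveD (du x) (dv x)).
Qed.

Lemma differentiable_uptoM k u v : differentiable_upto k u ->
  differentiable_upto k v -> differentiable_upto k (u \* v).
Proof.
elim: k u v => [|k IH] u v hu hv; move: (hu) (hv) => [du du'] [dv dv'].
  by split=> [x|]; [exact: derivableM|].
split=> [x|]; first exact: derivableM.
rewrite (_ : (u \* v)^`()%classic = (u \* v^`()%classic) \+ (v \* u^`()%classic)).
  by apply: differentiable_uptoD; apply: IH => //; exact: differentiable_uptoW.
by apply/funext => x; rewrite /= !derive1E (deriveM (du x) (dv x)).
Qed.

Lemma differentiable_uptoZ k a u :
  differentiable_upto k u -> differentiable_upto k (fun x => a * u x).
Proof.
move=> hu; apply: (@differentiable_uptoM k (cst a) u) => //.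
elim: k a {hu} => [|k IH] a.
  by split=> [x|]; [exact: derivable_cst|].
split=> [x|]; first exact: derivable_cst.
rewrite (_ : (cst a)^`()%classic = cst 0); first exact: IH.
by apply/funext => z; rewrite derive1_cst.
Qed.

Lemma differentiable_upto_affine k a b u :
  differentiable_upto k u -> differentiable_upto k (fun x => u (a * x + b)).
Proof.
have daff x : is_derive x 1 (fun x => a * x + b) a.
  apply: is_derive_eq; rewrite /GRing.scale/=.
  by rewrite addr0 mulr1.
have dcomp w : (forall x, derivable w x 1) ->
    forall x, derivable (fun x => w (a * x + b)) x 1.
  move=> dw x; apply/derivable1_diffP.
  apply: (@differentiable_comp _ _ _ _ (fun x => a * x + b) w).
    by apply/derivable1_diffP; exact: ex_derive.
  exact/derivable1_diffP.
elim: k u => [|k IH] u [du du'].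
  by split; [exact: dcomp|].
split; first exact: dcomp.
rewrite (_ : _^`()%classic = fun x => a * u^`()%classic (a * x + b)).
  exact/differentiable_uptoZ/IH.
apply/funext => x.
rewrite (@derive1_comp _ (fun x => a * x + b) u); last 2 first.
  exact: ex_derive.
  exact: du.
by rewrite mulrC [in LHS]derive1E; congr (_ * _); exact: derive_val.
Qed.

(** The linear span of these functions is stable under differentiation and contains
   exp (-1/x), extended by 0 to the negative half-line. *)
Definition flat n x : R := if 0 < x then x ^- n * expR (- x^-1) else 0.

Lemma flat_ge0 n x : 0 <= flat n x.
Proof.
rewrite /flat; case: ifPn => // x0.
by rewrite mulr_ge0 ?expR_ge0// invr_ge0 exprn_ge0// ltW.
Qed.

(** From exp (y / n) >= y / n, raised to the power n. *)
Lemma exprn_expRN_le n (y : R) : 0 <= y -> y ^+ n * expR (- y) <= n%:R ^+ n.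
Proof.
case: n => [|n] y0; first by rewrite !expr0 mul1r expR_le1 oppr_le0.
rewrite expRN ler_pdivrMr ?expR_gt0//.
have -> : expR y = expR (y / n.+1%:R) ^+ n.+1.
  by rewrite -expRM_natl mulrCA divff ?mulr1// pnatr_eq0.
rewrite -exprMn lerXn2r// ?nnegrE ?mulr_ge0 ?expR_ge0//.
rewrite -[leLHS](divfK (_ : n.+1%:R != 0)) ?pnatr_eq0// mulrC ler_wpM2l//.
by rewrite (le_trans _ (expR_ge1Dx _))// lerDr.
Qed.

(** Exponential decay beats every power of 1/x, hence the quadratic bound, which
   makes the derivative at the origin vanish. *)
Lemma flat_le n x : `|flat n x| <= n.+2%:R ^+ n.+2 * x ^+ 2.
Proof.
rewrite ger0_norm ?flat_ge0// /flat; case: ifPn => x0; last first.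
  by rewrite mulr_ge0 ?sqr_ge0// exprn_ge0.
have xi0 : 0 <= x^-1 by rewrite invr_ge0 ltW.
have := exprn_expRN_le n.+2 xi0.
rewrite -(ler_pM2r (exprn_gt0 2 x0)); apply: le_trans.
rewrite mulrAC ler_wpM2r ?expR_ge0// -exprVn -addn2 exprD -mulrA -exprMn.
by rewrite mulVf ?gt_eqF// expr1n mulr1.
Qed.

Lemma is_derive_flat n x :
  is_derive x 1 (flat n) (flat n.+2 x - n%:R * flat n.+1 x).
Proof.
have [x0|x0|->] := ltgtP x 0.
- rewrite {2 3}/flat lt_gtF// mulr0 subrr.
  apply: (@near_eq_is_derive _ _ _ (cst 0)).
  by near=> z; rewrite /flat lt_gtF//; near: z; exact: lt_nbhsl.
- rewrite {2 3}/flat x0.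
  apply: (@near_eq_is_derive R R R (fun z => z ^- n * expR (- z^-1))).
  - by near=> z; rewrite /flat ifT//; near: z; exact: lt_nbhsr.
  - have xn0 : x != 0 by rewrite gt_eqF.
    have D1 : is_derive x 1 (fun z : R => z^-1) (- x ^- 2).
      have := @is_deriveV R id x 1 1 xn0 (is_derive_id _ _).
      by rewrite /GRing.scale/= mulr1.
    have D2 : is_derive x 1 (fun z : R => expR (- z^-1)) (x ^- 2 * expR (- x^-1)).
      have D3 : is_derive x 1 (fun z : R => - z^-1) (x ^- 2).
        by apply: is_derive_eq; rewrite opprK.
      by rewrite mulrC; exact: (@is_derive1_comp R expR (fun z => - z^-1)).
    have D3 : is_derive x 1 (fun z : R => z ^- n) (- (n%:R * x ^- n.+1)).
      rewrite (_ : (fun z : R => z ^- n) = (fun z => z^-1) ^+ n); last first.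
        by apply/funext => z; rewrite -exprVn fctE.
      apply: is_derive_eq; rewrite /GRing.scale/=.
      case: n => [|n]; first by rewrite !mul0r oppr0.
      rewrite mulrN; congr (- _); rewrite /= -!exprVn -!mulrA; congr (_ * _).
      by rewrite -exprD addn2.
    apply: is_derive_eq; rewrite /GRing.scale/=.
    by rewrite -!exprVn !exprS; ring.
- rewrite {2 3}/flat ltxx mulr0 subrr.
  suff H : (fun h : R => h^-1 *: (flat n (h *: (1:R) + 0) - flat n 0)) @ 0^' --> (0 : R).
    by apply: DeriveDef; [apply/cvg_ex; exists 0|exact: cvg_lim H].
  apply/cvgr0Pnorm_le => e e0; set C : R := n.+2%:R ^+ n.+2.
  have C0 : 0 < C by rewrite exprn_gt0.
  near=> h.
  have h0 : h != 0 by near: h; exact: nbhs_dnbhs_neq.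
  rewrite /flat ltxx subr0 addr0 -/(flat n _) /GRing.scale/= mulr1.
  rewrite normrM normfV ler_pdivrMl ?normr_gt0// (le_trans (flat_le _ _))//.
  rewrite -/C -[h ^+ 2]ger0_norm ?sqr_ge0// normrX expr2 mulrCA ler_wpM2l//.
  rewrite -ler_pdivlMl//; near: h.
  by apply: dnbhs0_le; rewrite mulr_gt0// invr_gt0.
Unshelve. all: by end_near. Qed.

Lemma smooth_flat n : smooth1 (flat n).
Proof.
move=> k; elim: k n => [|k IH] n.
  by split=> [x|//]; apply: ex_derive; exact: is_derive_flat.
split=> [x|]; first by apply: ex_derive; exact: is_derive_flat.
rewrite (_ : _^`()%classic = flat n.+2 \+ (fun x => - n%:R * flat n.+1 x)).
  by apply: differentiable_uptoD => //; exact: differentiable_uptoZ.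
apply/funext => x; rewrite derive1E.
by have -> := @derive_val _ _ _ _ _ _ _ (is_derive_flat n x); rewrite /= mulNr.
Qed.

(** The numbers 3 and 4 matter: after dilation by s, the cube [3 s, 4 s]^d stays at
   distance 2 s from any set contained in [-s, s]^d, which in dimension 1 makes the
   gain in energy larger than the loss due to the diameter of the cube. *)
Definition bump x : R := flat 0 (x - 3) * flat 0 (4 - x).

Lemma smooth_bump_scale a : smooth1 (fun x => bump (a * x)).
Proof.
move=> k.
rewrite (_ : (fun x => _) =
    (fun x => flat 0 (a * x + - 3)) \* (fun x => flat 0 ((- a) * x + 4))).
  by apply: differentiable_uptoM; apply: differentiable_upto_affine;
     exact: smooth_flat.
by apply/funext => x; rewrite /bump/= mulNr (addrC _ 4).
Qed.

Lemma flat0_le1 x : flat 0 x <= 1.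
Proof.
rewrite /flat; case: ifPn => // x0.
by rewrite expr0 invr1 mul1r expR_le1 oppr_le0 invr_ge0 ltW.
Qed.

Lemma bump_ge0 x : 0 <= bump x.
Proof. by rewrite mulr_ge0 ?flat_ge0. Qed.

Lemma bump_le1 x : bump x <= 1.
Proof. by rewrite mulr_ile1 ?flat_ge0 ?flat0_le1. Qed.

Lemma bump_neq0 x : bump x != 0 -> 3 < x < 4.
Proof.
rewrite /bump /flat !subr_gt0; case: ifPn => x3; last by rewrite mul0r eqxx.
by case: ifPn => x4; [move=> _; apply/andP|rewrite mulr0 eqxx].
Qed.

(** On the middle third both factors are at least exp (-3). *)
Lemma bump_ge x : 10 / 3 <= x <= 11 / 3 -> expR (- 6) <= bump x.
Proof.
move=> /andP[x1 x2].
have F y : 3^-1 <= y -> expR (- 3) <= flat 0 y.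
  move=> y1; have y0 : 0 < y by rewrite (lt_le_trans _ y1).
  rewrite /flat y0 expr0 invr1 mul1r ler_expR lerN2.
  by rewrite -[leRHS]invrK lef_pV2 ?posrE.
rewrite (_ : - 6 = - 3 + - 3 :> R); last by lra.
by rewrite expRD ler_pM ?expR_ge0 ?F//; lra.
Qed.

End smooth_1d.

(** * Products of one-variable functions *)

Section tensor_product.
Context {R : realType} {d : nat}.
Implicit Types (u : 'I_d -> R -> R) (x : 'rV[R]_d).

Definition tensor u x : R := \prod_(i < d) u i (x ord0 i).

Lemma differentiable_tensor u x :
  (forall i, smooth1 (u i)) -> differentiable (tensor u) x.
Proof.
move=> su; rewrite /tensor.
elim: (index_enum _) => [|i s IH].
  rewrite (_ : (fun _ => _) = cst 1); first exact: differentiable_cst.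
  by apply/funext => y; rewrite big_nil.
rewrite (_ : (fun _ => _) = (fun y : 'rV[R]_d => u i (y ord0 i)) *
    (fun y => \prod_(j <- s) u j (y ord0 j))); last first.
  by apply/funext => y; rewrite big_cons.
apply: differentiableM => //.
apply: (@differentiable_comp _ _ _ _ (fun y : 'rV[R]_d => y ord0 i) (u i)).
  exact: differentiable_coord.
by apply/derivable1_diffP; have [] := su i 0.
Qed.

Lemma partial_tensor u j :
  (forall i, smooth1 (u i)) ->
  partial j (tensor u) =
  tensor (fun i => if i == j then (u i)^`()%classic else u i).
Proof.
move=> su; apply/funext => x; rewrite /partial /tensor (bigD1 j)//= eqxx.
rewrite (eq_bigr (fun i => u i (x ord0 i))); last by move=> i /negbTE ->.
set P := \prod_(i < d | _) _.
have duj : derivable (u j) (x ord0 j) 1 by have [] := su j 0.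
(* Along a coordinate axis only one factor varies. *)
transitivity ('D_1 (P \*o u j) (x ord0 j)); last first.
  by rewrite (deriveMl _ duj) derive1E mulrC.
rewrite /derive; set q := (X in lim (X @ _) = _).
set q' := (X in _ = lim (X @ _)); suff -> : q = q' by [].
apply/funext => h; rewrite {}/q {}/q' /=.
congr (_ *: (_ - _)); last by rewrite (bigD1 j)//= mulrC.
rewrite (bigD1 j)//= !mxE !eqxx mulrC; congr (_ * _).
rewrite /P; apply: eq_bigr => i ij.
by rewrite !mxE (negbTE ij) andbF mulr0 add0r.
Qed.

Lemma smooth1_derive (v : R -> R) : smooth1 v -> smooth1 v^`()%classic.
Proof. by move=> sv k; have [] := sv k.+1. Qed.

(** Partial derivatives of a product of one-variable functions are again such
   products, so that no sums are ever needed. *)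
Lemma smooth_tensor u : (forall i, smooth1 (u i)) -> smooth (tensor u).
Proof.
move=> su k; elim: k u su => [|k IH] u su.
  by split=> // x; apply: differentiable_continuous; exact: differentiable_tensor.
split=> [x|i]; first by apply: differentiable_continuous; exact: differentiable_tensor.
split=> [x|]; first by apply: diff_derivable; exact: differentiable_tensor.
rewrite partial_tensor//; apply: IH => j.
by case: eqP => // _; exact: smooth1_derive.
Qed.

End tensor_product.

(** * The Euclidean norm and the sup norm *)

Section euclidean.
Context {R : realType} {d : nat}.
Implicit Types x y : 'rV[R]_d.

Lemma coord_le_norm x i : `|x ord0 i| <= `|x|.
Proof.
by rewrite [leRHS]/Num.norm/= mx_normrE; apply/bigmax_geP; right; exists (ord0, i).
Qed.

Lemma norm_le_coord x r : 0 <= r -> (forall i, `|x ord0 i| <= r) -> `|x| <= r.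
Proof.
move=> r0 xr; rewrite [leLHS]/Num.norm/= mx_normrE; apply/bigmax_leP; split=> //.
by move=> [i j] _ /=; rewrite ord1.
Qed.

Lemma norm_lt_coord x r : 0 < r -> (`|x| < r) = [forall i, `|x ord0 i| < r].
Proof.
move=> r0; apply/idP/forallP => [xr i|xr].
  exact: le_lt_trans (coord_le_norm x i) xr.
rewrite [ltLHS]/Num.norm/= mx_normrE; apply/bigmax_ltP; split=> //.
by move=> [i j] _ /=; rewrite ord1.
Qed.

Lemma enorm_ge0 x : 0 <= enorm x.
Proof. exact: sqrtr_ge0. Qed.

Lemma sqr_enorm x : enorm x ^+ 2 = \sum_(i < d) x ord0 i ^+ 2.
Proof. by rewrite sqr_sqrtr// sumr_ge0// => i _; rewrite sqr_ge0. Qed.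

Lemma coord_le_enorm x i : `|x ord0 i| <= enorm x.
Proof.
rewrite -(@ler_pXn2r _ 2)// ?nnegrE ?enorm_ge0// sqr_enorm real_normK ?num_real//.
by rewrite (bigD1 i)//= lerDl sumr_ge0// => j _; rewrite sqr_ge0.
Qed.

Lemma norm_le_enorm x : `|x| <= enorm x.
Proof. by apply: norm_le_coord => [|i]; [exact: enorm_ge0|exact: coord_le_enorm]. Qed.

Lemma enorm_le_norm x : enorm x <= d%:R * `|x|.
Proof.
rewrite -(@ler_pXn2r _ 2)// ?nnegrE ?enorm_ge0 ?mulr_ge0// sqr_enorm.
apply: (@le_trans _ _ (\sum_(i < d) `|x| ^+ 2)).
  apply: ler_sum => i _; rewrite -real_normK ?num_real//.
  by rewrite lerXn2r// ?nnegrE// coord_le_norm.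
rewrite sumr_const card_ord -[leLHS]mulr_natl exprMn ler_wpM2r ?sqr_ge0//.
by rewrite -natrX ler_nat; case: d => // n; rewrite expnS expn1 leq_pmulr.
Qed.

Lemma enorm_eq0 x : (enorm x == 0) = (x == 0).
Proof.
apply/eqP/eqP => [x0|->]; last first.
  by rewrite /enorm big1 ?sqrtr0// => i _; rewrite mxE expr0n.
by apply/eqP; rewrite -normr_le0 (le_trans (norm_le_enorm x))// x0.
Qed.

Lemma enorm_gt0 x : (0 < enorm x) = (x != 0).
Proof. by rewrite lt_def enorm_ge0 andbT enorm_eq0. Qed.

(** A difference of squares replaces the triangle inequality here. *)
Lemma enorm_lipschitz x y : `|enorm x - enorm y| <= d%:R * `|x - y|.
Proof.
have [s0|s0] := eqVneq (enorm x + enorm y) 0.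
  have : enorm x = 0 /\ enorm y = 0.
    by move/eqP: s0; rewrite paddr_eq0 ?enorm_ge0// => /andP[/eqP ? /eqP ?].
  by move=> [-> ->]; rewrite subrr normr0 mulr_ge0.
have {}s0 : 0 < enorm x + enorm y by rewrite lt_def s0 addr_ge0 ?enorm_ge0.
rewrite -(ler_pM2r s0) -{1}[enorm x + enorm y]ger0_norm ?(ltW s0)// -normrM.
rewrite -subr_sqr !sqr_enorm -sumrB (le_trans (ler_norm_sum _ _ _))//.
apply: (@le_trans _ _ (\sum_(i < d) `|x - y| * (enorm x + enorm y))).
  apply: ler_sum => i _; rewrite subr_sqr normrM ler_pM//.
    by have := coord_le_norm (x - y) i; rewrite !mxE.
  by rewrite (le_trans (ler_normD _ _))// lerD// coord_le_enorm.
by rewrite sumr_const card_ord -[leLHS]mulr_natl mulrA.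
Qed.

Lemma lipschitz_continuous (f : 'rV[R]_d -> R) L :
  (forall x y, `|f x - f y| <= L * `|x - y|) -> continuous f.
Proof.
move=> fL x; apply/(@cvgrPdist_le _ _ _ (nbhs x) (nbhs_filter x)) => e e0.
have L1 : 0 < `|L| + 1 by rewrite ltr_wpDl.
have := nbhsx_ballx x _ (divr_gt0 e0 L1); apply: filterS => y.
rewrite mx_norm_ball /ball_/= => xy; rewrite (le_trans (fL x y))//.
rewrite (le_trans (ler_wpM2r _ (ler_norm L)))//.
rewrite (@le_trans _ _ ((`|L| + 1) * `|x - y|)) ?ler_wpM2r ?lerDl//.
by rewrite -ler_pdivlMl// mulrC ltW.
Qed.

Lemma continuous_enorm : continuous (@enorm R d).
Proof. exact: lipschitz_continuous enorm_lipschitz. Qed.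

End euclidean.

(** * Integrals with respect to a measure carried by a set *)

Section measure_tools.
Context d (T : measurableType d) (R : realType).
Local Open Scope ereal_scope.

Section density.
Variables (m : {measure set T -> \bar R}) (f : T -> R).
Hypotheses (mf : measurable_fun [set: T] f) (f0 : (forall x, 0 <= f x)%R)
  (f1 : \int[m]_x (f x)%:E = 1).

Definition with_density of measurable_fun [set: T] f & (forall x, 0 <= f x)%R
    & \int[m]_x (f x)%:E = 1 : set T -> \bar R :=
  fun A => \int[m]_(x in A) (f x)%:E.

Local Notation nu := (with_density mf f0 f1).

Let nu0 : nu set0 = 0.
Proof. by rewrite /with_density integral_set0. Qed.

Let nu_ge0 A : 0 <= nu A.
Proof. by apply: integral_ge0 => x _; rewrite lee_fin. Qed.

Let nu_sigma_additive : semi_sigma_additive nu.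
Proof.
move=> F mF tF mUF; rewrite /with_density ge0_integral_bigcup//=.
- by apply: is_cvg_nneseries => // n _ _; exact: nu_ge0.
- by apply/measurable_EFinP; exact: measurable_funTS.
- by move=> x _; rewrite lee_fin.
Qed.

HB.instance Definition _ := isMeasure.Build _ _ _ nu nu0 nu_ge0 nu_sigma_additive.
HB.instance Definition _ := Measure_isProbability.Build _ _ _ nu f1.

Lemma exists_probability_with_density : exists P : probability T R,
  forall A, measurable A -> P A = \int[m]_(x in A) (f x)%:E.
Proof. by exists nu. Qed.

End density.

(** Monotonicity of the integral holds without measurability, the integral of a
   nonnegative function being a supremum over simple functions below it. *)
Lemma ge0_le_integral_any (m : {measure set T -> \bar R}) (f g : T -> \bar R) :
  (forall x, 0 <= f x) -> (forall x, f x <= g x) ->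
  \int[m]_x f x <= \int[m]_x g x.
Proof.
move=> f0 fg; have g0 x : 0 <= g x by exact: le_trans (fg x).
rewrite !ge0_integralTE//; apply: ereal_sup_le => _ [h hf <-].
by exists h => // x; exact: le_trans (fg x).
Qed.

Variable P : probability T R.

(** The integrand is not assumed measurable: off the carrier S it is compared with
   the constant +oo, whose integral over a null set vanishes. *)
Lemma integral_le_on_support (S : set T) (f : T -> \bar R) (b : R) :
  measurable S -> P (~` S) = 0 -> (forall x, 0 <= f x) ->
  (forall x, S x -> f x <= b%:E) -> (0 <= b)%R -> \int[P]_x f x <= b%:E.
Proof.
move=> mS PS f0 fb b0.
pose F x := if x \in S then b%:E else +oo.
have F0 x : 0 <= F x by rewrite /F; case: ifP; rewrite ?lee_fin ?leey.
have mF : measurable_fun [set: T] F.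
  apply: measurable_fun_ifT => //.
  apply: (@measurable_fun_bool _ _ _ _ true); rewrite setTI.
  rewrite (_ : _ @^-1` _ = S)//.
  by apply/seteqP; split=> x /=; [exact: set_mem|exact: mem_set].
apply: (le_trans (ge0_le_integral_any (g := F) _ f0 _)).
  by move=> x; rewrite /F; case: ifPn; [rewrite inE; exact: fb|rewrite leey].
rewrite (ge0_negligible_integral (measurableC mS))// setTD setCK.
rewrite (eq_integral (cst b%:E)); last by move=> x xS; rewrite /F xS.
rewrite integral_cst// -[leRHS]mule1 lee_wpmul2l ?lee_fin//.
exact: probability_le1.
Qed.

Lemma integrable_on_support (S : set T) (f : T -> \bar R) :
  measurable S -> P (~` S) = 0 -> measurable_fun [set: T] f ->
  P.-integrable S f -> P.-integrable [set: T] f.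
Proof.
move=> mS PS mf iS.
apply/(negligible_integrable (measurableC mS) measurableT mf PS).
by rewrite setTD setCK.
Qed.

Lemma le_Rintegral_on_support (S : set T) (u v : T -> R) :
  measurable S -> P (~` S) = 0 ->
  P.-integrable [set: T] (EFin \o u) -> P.-integrable [set: T] (EFin \o v) ->
  (forall x, S x -> u x <= v x)%R ->
  (\int[P]_x u x <= \int[P]_x v x)%R.
Proof.
move=> mS PS iu iv uv; rewrite /Rintegral.
rewrite (negligible_integral (measurableC mS) _ iu)//.
rewrite (negligible_integral (measurableC mS) _ iv)// setTD setCK.
by apply: le_Rintegral => //; [exact: integrableS iu|exact: integrableS iv].
Qed.

Lemma integrable_constant (a : R) : P.-integrable [set: T] (EFin \o cst a).
Proof. exact: finite_measure_integrable_cst. Qed.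

Lemma Rintegral_constant (a : R) : (\int[P]_(x in [set: T]) (cst a x))%R = a.
Proof. by rewrite Rintegral_cst//= probability_setT mulr1. Qed.

Lemma integrable_bounded (S : set T) (u : T -> R) (b : R) :
  measurable S -> P (~` S) = 0 -> measurable_fun [set: T] u ->
  (forall x, S x -> `|u x| <= b)%R -> P.-integrable [set: T] (EFin \o u).
Proof.
move=> mS PS mu ub; apply: (integrable_on_support mS) => //.
  exact/measurable_EFinP.
apply: (@le_integrable _ _ _ _ _ _ _ (EFin \o cst b)) => //.
- by apply/measurable_EFinP; exact: measurable_funTS.
- move=> x Sx /=; rewrite lee_fin (le_trans (ub _ Sx))//; exact: ler_norm.
- exact: finite_measure_integrable_cst.
Qed.

End measure_tools.

(** * Boxes and measures with a bounded density *)

Section borel_sets.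
Context {R : realType} {d : nat}.
Implicit Types (x y z : 'rV[R]_d) (r : R).

Lemma open_measurable_borel (A : set 'rV[R]_d) :
  open A -> measurable (A : set (borel R d)).
Proof. exact: sub_sigma_algebra. Qed.

Lemma continuous_measurable_borel (f : 'rV[R]_d -> R) :
  continuous f -> measurable_fun [set: borel R d] (f : borel R d -> R).
Proof.
move=> /continuousP cf; apply: (measurability _ (RGenOpens.measurableE R)) => //.
move=> _ [_ [a [b ->] <-]]; rewrite setTI; apply: open_measurable_borel.
exact/cf/interval_open.
Qed.

Lemma measurable_inv : measurable_fun [set: R] (@GRing.inv R).
Proof.
rewrite -(setUv [set (0 : R)]); apply/measurable_funU => //.
- exact: measurableC.
- split; first exact: measurable_fun_set1.
  apply: open_continuous_measurable_fun.
    exact/closed_openC/accessible_closed_set1/hausdorff_accessible/Rhausdorff.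
  by move=> x; rewrite inE/= => /eqP x0; exact: inv_continuous.
Qed.

Lemma measurable_enorm_shift x :
  measurable_fun [set: borel R d] (fun y : borel R d => enorm (x - (y : 'rV[R]_d))).
Proof.
apply: continuous_measurable_borel.
apply: (@lipschitz_continuous _ _ _ d%:R) => y z.
rewrite (le_trans (enorm_lipschitz _ _))//.
by rewrite opprB addrC addrA subrK distrC.
Qed.

(** Boxes, i.e. balls of the sup norm, are the sets on which Lebesgue measure is
   known. *)
Definition box z r : set 'rV[R]_d := [set y | `|z - y| < r].
Definition cbox z r : set 'rV[R]_d := [set y | `|z - y| <= r].

Lemma continuous_dist z : continuous (fun y : 'rV[R]_d => `|z - y|).
Proof.
apply: (@lipschitz_continuous _ _ _ 1) => x y; rewrite mul1r.
rewrite (le_trans (ler_dist_dist _ _))//.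
by rewrite opprB addrC addrA subrK distrC.
Qed.

Lemma measurable_dist z :
  measurable_fun [set: borel R d] (fun y : borel R d => `|z - (y : 'rV[R]_d)|).
Proof. by apply: continuous_measurable_borel; exact: continuous_dist. Qed.

Lemma measurable_box z r : measurable (box z r : set (borel R d)).
Proof.
rewrite -[X in measurable X]setTI.
rewrite (_ : box z r = (fun y => `|z - y|) @^-1` `]-oo, r[%classic).
  exact: (@measurable_dist z measurableT _ (measurable_itv _)).
by apply/seteqP; split=> y; rewrite ?/box ?/cbox/= in_itv.
Qed.

Lemma measurable_cbox z r : measurable (cbox z r : set (borel R d)).
Proof.
rewrite -[X in measurable X]setTI.
rewrite (_ : cbox z r = (fun y => `|z - y|) @^-1` `]-oo, r]%classic).
  exact: (@measurable_dist z measurableT _ (measurable_itv _)).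
by apply/seteqP; split=> y; rewrite ?/box ?/cbox/= in_itv.
Qed.

Lemma lebesgue_box z r : 0 < r ->
  lebesgue_rV (box z r : set (borel R d)) = ((r *+ 2) ^+ d)%:E.
Proof.
move=> r0.
rewrite (_ : box z r = [set y | forall i, ball (z ord0 i) r (y ord0 i)]).
  rewrite (@lebesgue_rV_box R d (fun i => ball (z ord0 i) r)); last first.
    by move=> i; exact: measurable_ball.
  under eq_bigr do rewrite lebesgue_measure_ball ?(ltW r0)//.
  by rewrite prodEFin prodr_const card_ord.
apply/seteqP; split=> y; rewrite /box/= norm_lt_coord//.
  by move=> /forallP zy i; have := zy i; rewrite !mxE.
by move=> zy; apply/forallP => i; rewrite !mxE; exact: zy.
Qed.

End borel_sets.

Section growth.
Context {R : realType} {d : nat}.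
Implicit Types (x y z : 'rV[R]_d) (r K : R) (nu : probability (borel R d) R).

Definition dominated nu K := forall A : set (borel R d), measurable A ->
  (nu A <= K%:E * lebesgue_rV A)%E.

Lemma dominated_density nu (f : borel R d -> R) K :
  measurable_fun [set: borel R d] f -> 0 <= K ->
  {ae (lebesgue_rV (d:=d)), forall x, `|f x| <= K} ->
  has_density nu f -> dominated nu K.
Proof.
move=> mf K0 fK nuf A mA; rewrite nuf//.
rewrite (le_trans (lee_abs _))//.
apply: (le_trans (le_abse_integral _ _ _)) => //.
  by apply/measurable_EFinP; exact: measurable_funTS.
apply: integral_le_bound => //.
- by apply/measurable_EFinP; exact: measurable_funTS.
- have FF := ae_filter_ringOfSetsType (@lebesgue_rV R d).
  by apply: filterS fK => x /= fxK _; rewrite lee_fin.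
Qed.

Lemma dominated_Linfty nu : Linfty_density nu ->
  exists2 K, 0 <= K & dominated nu K.
Proof.
move=> [f fL nuf].
have mf : measurable_fun [set: borel R d] f := set_mem (sub_Lfun_mfun fL).
have := set_mem (sub_Lfun_finLfun fL); rewrite /finite_norm unlock /=.
rewrite ifT => [sup_fin|]; last first.
  rewrite (@lt_le_trans _ _ (lebesgue_rV (box 0 1 : set (borel R d))))//.
    by rewrite lebesgue_box// lte_fin exprn_gt0.
  by apply: le_measure; rewrite ?inE//; exact: measurable_box.
pose K := fine (maxe 0 (ess_sup (lebesgue_rV (d:=d)) (abse \o (EFin \o f))))%E.
have K0 : 0 <= K by rewrite fine_ge0// le_max lexx.
exists K => //; apply: (@dominated_density nu f) => //.
have FF := ae_filter_ringOfSetsType (@lebesgue_rV R d).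
apply: filterS (ess_sup_ge (lebesgue_rV (d:=d)) (abse \o (EFin \o f))) => x /= fx.
rewrite -lee_fin /K fineK; first by rewrite le_max fx orbT.
by rewrite ge0_fin_numE ?le_max ?lexx// gt_max ltry; exact: sup_fin.
Qed.

End growth.

(** * The area of the sphere and the radial profile of the kernel *)

Section sphere.
Context {R : realType} {d : nat}.
Implicit Types (x y z : 'rV[R]_d) (r a b : R).

Lemma enormZ r x : enorm (r *: x) = `|r| * enorm x.
Proof.
rewrite /enorm -sqrtr_sqr -sqrtrM ?sqr_ge0// mulr_sumr; congr Num.sqrt.
by apply: eq_bigr => i _; rewrite mxE exprMn.
Qed.

Lemma cone_sphereE :
  [set x : borel R d | exists r : R, exists2 u : 'rV[R]_d,
     enorm u = 1 & (0 < r <= 1)%R /\ x = (r *: u)%R] =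
  [set x : borel R d | 0 < enorm (x : 'rV[R]_d) <= 1].
Proof.
apply/seteqP; split=> x /= => [[r [u u1 [/andP[r0 r1] ->]]]|/andP[x0 x1]].
  by rewrite enormZ u1 mulr1 gtr0_norm// r0.
exists (enorm x), ((enorm x)^-1 *: (x : 'rV[R]_d)).
  by rewrite enormZ gtr0_norm ?invr_gt0// mulVf// gt_eqF.
by rewrite x0 x1; split=> //; rewrite scalerA divff ?scale1r// gt_eqF.
Qed.

(** Finiteness of the area enters as well as its positivity: [fine] of an infinite
   measure would be 0, and the kernel would vanish.  The punctured ball contains a
   box and is contained in another one. *)
Lemma sphere_area_gt0 : (0 < d)%N -> 0 < @sphere_area R d.
Proof.
move=> d0; rewrite /sphere_area /surface_measure cone_sphereE.
set A := [set x | _].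
have mA : measurable (A : set (borel R d)).
  have -> : A = (fun x : borel R d => enorm (x : 'rV[R]_d)) @^-1` `]0, 1]%classic.
    by apply/seteqP; split=> x; rewrite /A/= in_itv.
  rewrite -[X in measurable X]setTI.
  apply: (continuous_measurable_borel (@continuous_enorm R d)) => //.
pose q : R := (2 * d%:R)^-1.
have dR : 0 < d%:R :> R by rewrite ltr0n.
have q0 : 0 < q by rewrite invr_gt0 mulr_gt0.
pose z : 'rV[R]_d := \row_i q.
have zA : box z q `<=` A.
  move=> y; rewrite /box/= => yq.
  have zq : `|z| <= q.
    by apply: norm_le_coord => [|i]; [exact: ltW|rewrite mxE gtr0_norm].
  have y0 : y != 0.
    apply: contraTneq yq => ->; rewrite subr0 -leNgt.
    by have := coord_le_norm z (Ordinal d0); rewrite mxE gtr0_norm.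
  rewrite /A/= enorm_gt0 y0/= (le_trans (enorm_le_norm y))//.
  rewrite -ler_pdivlMl// mulr1.
  have -> : y = z - (z - y) by rewrite opprB addrC subrK.
  rewrite (le_trans (ler_normB _ _))// (le_trans (lerD zq (ltW yq)))//.
  by rewrite -mulr2n -[_ *+ 2]mulr_natl /q invfM mulrA divff// mul1r.
have AB : A `<=` box 0 2.
  move=> y; rewrite /A/box/= sub0r normrN => /andP[_ y1].
  by rewrite (le_lt_trans (norm_le_enorm y))// (le_lt_trans y1)// ltr1n.
have lo : (0 < lebesgue_rV (A : set (borel R d)))%E.
  rewrite (@lt_le_trans _ _ (lebesgue_rV (box z q : set (borel R d))))//.
    by rewrite lebesgue_box// lte_fin exprn_gt0// mulrn_wgt0.
  by apply: le_measure; rewrite ?inE//; exact: measurable_box.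
have hi : (lebesgue_rV (A : set (borel R d)) < +oo)%E.
  rewrite (@le_lt_trans _ _ (lebesgue_rV (box 0 2 : set (borel R d))))//.
    by apply: le_measure; rewrite ?inE//; exact: measurable_box.
  by rewrite lebesgue_box// ltry.
rewrite fine_gt0//; apply/andP; split; first by rewrite mule_gt0// lte_fin.
by rewrite lte_mul_pinfty// lee_fin.
Qed.

End sphere.

Section profile.
Context {R : realType} (d : nat).
Implicit Types (x : 'rV[R]_d) (r a b : R).

(** The Coulomb kernel as a function of the distance to the origin. *)
Definition coulomb_profile (r : R) : R :=
  match d with
  | 0 => 0
  | 1 => - (2^-1 * r)
  | 2 => - ((2 * pi)^-1 * ln r)
  | _ => ((d - 2)%N%:R * @sphere_area R d)^-1 * r ^- (d - 2)
  end.

Lemma coulombE x : coulomb x = coulomb_profile (enorm x).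
Proof. by []. Qed.

Lemma coulomb_profile0 : (0 < d)%N -> coulomb_profile 0 = 0.
Proof.
rewrite /coulomb_profile; case: d => [|[|[|n]]] //= _.
- by rewrite mulr0 oppr0.
- by rewrite ln0// mulr0 oppr0.
- by rewrite expr0n/= invr0 mulr0.
Qed.

Lemma coulomb_profile_nincr a b :
  0 < a -> a <= b -> coulomb_profile b <= coulomb_profile a.
Proof.
move=> a0 ab; have b0 : 0 < b by exact: lt_le_trans ab.
rewrite /coulomb_profile.
have := @sphere_area_gt0 R d; case: d => [|[|[|n]]] // s0.
- by rewrite lerN2 ler_wpM2l// invr_ge0.
- rewrite lerN2 ler_wpM2l//; last by rewrite ler_ln ?posrE.
  by rewrite invr_ge0 mulr_ge0// pi_ge0.
- rewrite ler_wpM2l//; first by rewrite invr_ge0 mulr_ge0// ltW// s0.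
  by rewrite lef_pV2 ?posrE ?exprn_gt0// lerXn2r// nnegrE ltW.
Qed.

Lemma ln_lipschitz a b : 0 < a -> 0 < b ->
  `|ln a - ln b| <= `|a - b| * (a^-1 + b^-1).
Proof.
wlog ba : a b / b <= a => [H a0 b0|a0 b0].
  have [/H|/ltW/H] := leP b a; first exact.
  by move=> /(_ b0 a0); rewrite distrC (distrC b) (addrC b^-1).
rewrite ger0_norm ?subr_ge0 ?ler_ln ?posrE// ger0_norm ?subr_ge0//.
rewrite -ln_div ?posrE//.
rewrite (@le_trans _ _ (a / b - 1))//.
  by have := @le_ln1Dx R (a / b - 1); rewrite addrCA subrr addr0; apply;
     rewrite ltrBrDl addrN divr_gt0.
rewrite -[X in _ - X](divff (lt0r_neq0 b0)) -mulrBl ler_wpM2l ?subr_ge0//.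
by rewrite lerDr invr_ge0 ltW.
Qed.

(** The geometric factorization of a difference of powers of a^-1 and b^-1, each
   term being bounded by a power of the larger one, b^-1. *)
Lemma exprVn_lipschitz m a b : 0 < a -> 0 < b ->
  `|a ^- m - b ^- m| <= m%:R * `|a - b| * (a ^- m.+1 + b ^- m.+1).
Proof.
wlog ba : a b / b <= a => [H a0 b0|a0 b0].
  have [/H|/ltW/H] := leP b a; first exact.
  by move=> /(_ b0 a0); rewrite distrC (distrC b) (addrC (b ^- _)).
have ib : a^-1 <= b^-1 by rewrite lef_pV2.
have ia0 : 0 < a^-1 by rewrite invr_gt0.
have ib0 : 0 < b^-1 by rewrite invr_gt0.
rewrite -!exprVn subrXX normrM.
apply: (@le_trans _ _ ((`|a - b| * (b^-1 * b^-1)) * (m%:R * b^-1 ^+ m.-1))).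
  apply: ler_pM => //.
    rewrite (_ : a^-1 - b^-1 = - (a - b) * (a^-1 * b^-1)); last first.
      by field; rewrite !gt_eqF.
    rewrite normrM normrN ler_wpM2l// gtr0_norm ?mulr_gt0//.
    by rewrite ler_wpM2r// ltW.
  rewrite (le_trans (ler_norm_sum _ _ _))// mulr_natl.
  rewrite -[X in _ *+ X]card_ord -sumr_const; apply: ler_sum => i _.
  rewrite ger0_norm ?mulr_ge0 ?exprn_ge0 ?(ltW ia0) ?(ltW ib0)//.
  rewrite (@le_trans _ _ (b^-1 ^+ (m.-1 - i) * b^-1 ^+ i))//.
    rewrite -subn1 -subnDA add1n ler_wpM2r ?exprn_ge0 ?(ltW ib0)//.
    by rewrite lerXn2r// nnegrE ltW.
  by rewrite -exprD subnK// -ltnS prednK// (leq_ltn_trans _ (ltn_ord i)).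
case: m => [|m]; first by rewrite !mul0r mulr0.
rewrite /= mulrACA [X in X * _]mulrC -!mulrA ler_wpM2l// ler_wpM2l//.
by rewrite -!exprS lerDr exprn_ge0// ltW.
Qed.

(** The gradient of the Coulomb kernel is of size |x|^(1-d); this is the
   mean value form of that fact. *)
Lemma coulomb_profile_lipschitz : (0 < d)%N -> exists2 C, 0 <= C &
  forall a b, 0 < a -> 0 < b ->
  `|coulomb_profile a - coulomb_profile b| <=
    C * `|a - b| * (a ^- d.-1 + b ^- d.-1).
Proof.
move=> d0; have := @sphere_area_gt0 R d d0.
rewrite /coulomb_profile; move: d0; case: d => [|[|[|n]]] // _ s0.
- exists 1 => // a b _ _; rewrite !expr0 !invr1 mul1r.
  rewrite -opprD normrN -mulrN -mulrDr normrM ger0_norm ?invr_ge0//.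
  by rewrite mulrC ler_wpM2l//; lra.
- exists (2 * pi)^-1; first by rewrite invr_ge0 mulr_ge0// pi_ge0.
  move=> a b a0 b0; rewrite !expr1.
  rewrite -opprD normrN -mulrN -mulrDr normrM ger0_norm.
    by rewrite -mulrA ler_wpM2l ?ln_lipschitz// invr_ge0 mulr_ge0// pi_ge0.
  by rewrite invr_ge0 mulr_ge0// pi_ge0.
- set k := (_ * _)^-1; have k0 : 0 <= k by rewrite invr_ge0 mulr_ge0// ltW.
  exists (k * (n.+3 - 2)%N%:R); first by rewrite mulr_ge0.
  move=> a b a0 b0; rewrite -mulrBr normrM ger0_norm// -!mulrA ler_wpM2l//.
  by rewrite mulrA (exprVn_lipschitz (n.+3 - 2)).
Qed.

End profile.

(** * The energy gap *)

Section energy_gap.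
Context {R : realType} (d : nat).
Implicit Types (s M B e c : R).

(** A lower bound for twice the energy, when the supports have diameters at most
   d s and 2 d M and are at distance at least 2 s of each other. *)
Definition energy_gap M s : R :=
  coulomb_profile d (d%:R * s) + coulomb_profile d (2 * d%:R * M) -
  2 * coulomb_profile d (2 * s).

(** For d = 2 the gap is a multiple of ln (s / (2 M)), at least ln 2 once s >= 4 M;
   for d >= 3 its middle term is positive and the negative one tends to 0. *)
Lemma energy_gap_ge M : (1 < d)%N -> 0 < M ->
  exists2 c, 0 < c & exists s0, forall s, s0 <= s -> c <= energy_gap M s.
Proof.
rewrite /energy_gap /coulomb_profile.
have := @sphere_area_gt0 R d; case: d => [|[|[|n]]] // s0 _ M0.
- have k0 : 0 < (2 * pi)^-1 :> R by rewrite invr_gt0 mulr_gt0// pi_gt0.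
  exists ((2 * pi)^-1 * ln 2); first by rewrite mulr_gt0// ln_gt0// ltr1n.
  exists (4 * M) => s sM; have s_gt0 : 0 < s by rewrite (lt_le_trans _ sM)// mulr_gt0.
  rewrite (_ : _ - _ = (2 * pi)^-1 * (ln (2 * s) - ln (2 * 2 * M))); last by ring.
  rewrite ler_wpM2l ?(ltW k0)// -ln_div ?posrE ?mulr_gt0// ler_ln ?posrE ?divr_gt0 ?mulr_gt0//.
  by rewrite ler_pdivlMr ?mulr_gt0//; lra.
- set m := (n.+3 - 2)%N; set k := (_ * _)^-1.
  have k0 : 0 < k by rewrite invr_gt0 mulr_gt0// ?s0// ltr0n.
  set q := (2 * n.+3%:R * M) ^- m.
  have q0 : 0 < q by rewrite invr_gt0 exprn_gt0// !mulr_gt0.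
  exists (k * q / 2); first by rewrite !mulr_gt0.
  exists (1 + 4 / q) => s ss.
  have s1 : 1 <= s by rewrite (le_trans _ ss)// lerDl divr_ge0// ltW.
  have s_gt0 : 0 < s by exact: lt_le_trans s1.
  have sm : (2 * s) ^- m <= s^-1.
    rewrite lef_pV2 ?posrE ?exprn_gt0 ?mulr_gt0//.
    rewrite /m subSS subSS subn0 exprS.
    rewrite -[leLHS]mulr1 ler_pM ?(ltW s_gt0)//; first by lra.
    by rewrite exprn_ege1//; lra.
  have sq : s^-1 <= q / 4.
    rewrite -[q / 4]invrK lef_pV2 ?posrE ?invr_gt0 ?divr_gt0// invf_div.
    by rewrite (le_trans _ ss)// lerDr.
  have : k * (2 * s) ^- m <= k * (q / 4) by rewrite ler_wpM2l ?(ltW k0)// (le_trans sm).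
  have : 0 <= k * (n.+3%:R * s) ^- m.
    by rewrite mulr_ge0 ?(ltW k0)// invr_ge0 exprn_ge0// mulr_ge0// ltW.
  lra.
Qed.

(** What makes the ratio of the two functionals tend to 0: in dimension 1 the gap
   is of order s, and in higher dimensions it is bounded below while s^(2(1-d))
   tends to 0. *)
Lemma energy_gap_dominates M B e : (0 < d)%N -> 0 < M -> 0 <= B -> 0 < e ->
  exists s0, forall s, s0 <= s ->
  [/\ 0 < s, 0 < energy_gap M s & B * (s ^- d.-1) ^+ 2 <= e * energy_gap M s].
Proof.
move=> d0 M0 B0 e0; have [d1|d1] := leqP d 1.
  have dE : d = 1%N by apply/eqP; rewrite eqn_leq d1.
  exists (M + B / e + 1) => s ss.
  have Be : 0 <= B / e by rewrite divr_ge0// ltW.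
  have gs : B / e + 1 <= energy_gap M s.
    by rewrite /energy_gap /coulomb_profile dE; lra.
  split; [lra|lra|].
  rewrite dE expr0 invr1 expr1n mulr1 (le_trans _ (ler_wpM2l (ltW e0) gs))//.
  by rewrite mulrDr mulrCA divff ?gt_eqF// mulr1; lra.
have [c c0 [s0 hs]] := energy_gap_ge d1 M0.
exists (Num.max s0 (1 + B / (e * c))) => s; rewrite ge_max => /andP[ss sB].
have ec : 0 < e * c by rewrite mulr_gt0.
have Bec : 0 <= B / (e * c) by rewrite divr_ge0// ltW.
have s1 : 1 <= s by lra.
have s_gt0 : 0 < s by lra.
have cg := hs s ss.
split; [lra|lra|].
rewrite (le_trans _ (ler_wpM2l (ltW e0) cg))//.
rewrite -exprVn -exprM exprVn ler_pdivrMr ?exprn_gt0//.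
rewrite (@le_trans _ _ (e * c * s))//.
  by rewrite -ler_pdivrMl// mulrC; lra.
rewrite ler_wpM2l ?(ltW ec)// ler_eXnr// muln_gt0 andbT.
by rewrite -ltnS prednK.
Qed.

End energy_gap.

(** * The Riesz kernel of exponent d - 1 *)

Section riesz.
Context {R : realType} (m : nat).
Local Notation d := m.+1.
Implicit Types (x y z : 'rV[R]_d) (r K M delta : R).
Implicit Types nu : probability (borel R d) R.

Definition riesz x : R := enorm x ^- m.

Lemma riesz_ge0 x : 0 <= riesz x.
Proof. by rewrite invr_ge0 exprn_ge0// enorm_ge0. Qed.

Lemma measurable_riesz_shift z : measurable_fun [set: borel R d]
  (fun y : borel R d => riesz (z - (y : 'rV[R]_d))).
Proof.
apply: (measurableT_comp measurable_inv).
by apply: measurable_funX; exact: measurable_enorm_shift.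
Qed.

Lemma riesz_le r x : 0 < r -> r <= `|x| -> riesz x <= r ^- m.
Proof.
move=> r0 rx; have e0 : 0 < enorm x.
  by rewrite (lt_le_trans r0)// (le_trans rx)// norm_le_enorm.
rewrite /riesz lef_pV2 ?posrE ?exprn_gt0// lerXn2r ?nnegrE ?enorm_ge0 ?(ltW r0)//.
by rewrite (le_trans rx)// norm_le_enorm.
Qed.

Lemma riesz0_le r : 0 < r -> riesz (0 : 'rV[R]_d) <= r ^- m.
Proof.
move=> r0; rewrite /riesz; have /eqP -> : enorm (0 : 'rV[R]_d) == 0.
  by rewrite enorm_eq0.
case: m => [|n]; first by rewrite !expr0.
by rewrite expr0n/= invr0 invr_ge0 exprn_ge0// ltW.
Qed.

Definition dyadic delta (k : nat) : R := delta / (2 ^ k)%:R.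

Lemma dyadic_gt0 delta k : 0 < delta -> 0 < dyadic delta k.
Proof. by move=> d0; rewrite divr_gt0// ltr0n expn_gt0. Qed.

(** The k-th term of the series majorizes the kernel on the k-th dyadic shell, and
   the constant majorizes it outside of the largest box. *)
Lemma riesz_dyadic_le delta z y : 0 < delta ->
  ((riesz (z - y))%:E <= (delta ^- m)%:E +
   \sum_(k <oo) ((dyadic delta k / 2) ^- m * \1_(box z (dyadic delta k)) y)%:E)%E.
Proof.
move=> delta0.
have term_ge0 k : (0 <= ((dyadic delta k / 2) ^- m *
    \1_(box z (dyadic delta k)) y)%:E)%E.
  by rewrite lee_fin mulr_ge0// invr_ge0 exprn_ge0// divr_ge0// ltW// dyadic_gt0.
have sum_ge0 : (0 <= \sum_(k <oo) ((dyadic delta k / 2) ^- m *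
    \1_(box z (dyadic delta k)) y)%:E)%E.
  by apply: nneseries_ge0 => k _ _; exact: term_ge0.
have [far|near] := leP delta `|z - y|.
  by rewrite -[leLHS]adde0 leeD// lee_fin riesz_le.
have [->|zy] := eqVneq (z - y) 0.
  by rewrite -[leLHS]adde0 leeD// lee_fin riesz0_le.
have t0 : 0 < `|z - y| by rewrite normr_gt0.
(* The first dyadic radius below the distance from z to y selects the shell. *)
have [k0 k0P] : exists k, dyadic delta k / 2 <= `|z - y|.
  pose k := Num.truncn (delta / `|z - y|); exists k.
  rewrite -mulrA -invfM ler_pdivrMr ?mulr_gt0 ?ltr0n ?expn_gt0//.
  rewrite -ler_pdivrMl// mulrC (le_trans (ltW (truncnS_gt _)))//.
  rewrite -/k -natrM ler_nat (leq_trans (ltn_expl k (ltnSn 1)))//.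
  by rewrite leq_pmulr.
have := ex_intro (fun k => is_true (dyadic delta k / 2 <= `|z - y|)) k0 k0P.
move=> exk; case: (ex_minnP exk) => k kP kmin.
have yk : box z (dyadic delta k) y.
  rewrite /box/=; case: k kP kmin => [_ _|k _ kmin].
    by rewrite /dyadic expn0 divr1.
  rewrite ltNge; apply/negP => H.
  suff /kmin : dyadic delta k / 2 <= `|z - y| by rewrite ltnn.
  by rewrite (le_trans _ H)// /dyadic expnSr natrM invfM mulrA.
rewrite -[leLHS]add0e leeD//; first by rewrite lee_fin invr_ge0 exprn_ge0// ltW.
apply: (@le_trans _ _ (\sum_(0 <= i < k.+1) ((dyadic delta i / 2) ^- m *
    \1_(box z (dyadic delta i)) y)%:E)%E); last exact: nneseries_lim_ge.
rewrite big_nat_recr//= -[leLHS]add0e leeD//; first exact: sume_ge0.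
rewrite lee_fin indicE mem_set// mulr1 riesz_le// divr_gt0//.
exact: dyadic_gt0.
Qed.

(** The singularity is integrated over dyadic shells: on the shell of radius r the
   kernel is at most of order r^(1-d), and the shell has mass of order r^d. *)
Lemma integral_riesz_le nu z delta K : 0 < delta -> 0 <= K ->
  (forall r, 0 < r -> r <= delta ->
    (nu (box z r : set (borel R d)) <= (K * r ^+ d)%:E)%E) ->
  (\int[nu]_(y in [set: borel R d]) (riesz (z - (y : 'rV[R]_d)))%:E <=
   (delta ^- m + K * 2 ^+ d * delta)%:E)%E.
Proof.
move=> delta0 K0 nuK.
pose t k (y : borel R d) : \bar R := ((dyadic delta k / 2) ^- m *
  \1_(box z (dyadic delta k) : set (borel R d)) y)%:E.
have c0 k : 0 <= (dyadic delta k / 2) ^- m.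
  by rewrite invr_ge0 exprn_ge0// divr_ge0// ltW// dyadic_gt0.
have t0 k y : (0 <= t k y)%E by rewrite lee_fin mulr_ge0.
have mt k : measurable_fun [set: borel R d] (t k).
  apply/measurable_EFinP; apply: measurable_funM => //.
  by apply: measurable_indic; exact: measurable_box.
apply: (@le_trans _ _ (\int[nu]_(y in [set: borel R d])
    ((delta ^- m)%:E + \sum_(k <oo) t k y))%E).
  apply: ge0_le_integral_any => y; first by rewrite lee_fin riesz_ge0.
  exact: riesz_dyadic_le.
rewrite ge0_integralD//; last first.
- exact: ge0_emeasurable_sum.
- by move=> y _; apply: nneseries_ge0.
- by move=> y _; rewrite lee_fin invr_ge0 exprn_ge0// ltW.
rewrite integral_cst//= probability_setT mule1 EFinD leeD//.
rewrite integral_nneseries//.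
apply: (le_trans _ (epsilon_trick0 xpredT _)); last first.
  by rewrite !mulr_ge0// ltW.
apply: lee_nneseries => [k _ _|k _]; first exact: integral_ge0.
rewrite /t (integralZl_indic _
  (fun=> box z (dyadic delta k) : set (borel R d)))//; last exact: measurable_box.
  rewrite integral_indic//; last exact: measurable_box.
  rewrite setIT.
  have dk := dyadic_gt0 k delta0.
  apply: (@le_trans _ _ ((((dyadic delta k / 2) ^- m)%:E * (K * dyadic delta k ^+ d)%:E)%E)).
    rewrite lee_wpmul2l ?lee_fin// nuK//.
    by rewrite ler_pdivrMr ?ltr0n ?expn_gt0// ler_peMr ?(ltW delta0)// ler1n expn_gt0.
  rewrite -EFinM lee_fin le_eqVlt; apply/orP; left; apply/eqP.
  have -> : K * 2 ^+ d * delta / (2 ^ k.+1)%:R = K * 2 ^+ d * (dyadic delta k / 2).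
    by rewrite /dyadic expnSr natrM invfM !mulrA.
  have := lt0r_neq0 dk; set q := dyadic _ _ => q0.
  by rewrite !exprS expr_div_n; field; rewrite !expf_neq0// pnatr_eq0.
by move=> neg; move: (c0 k); rewrite leNgt neg.
Qed.

End riesz.

(** * Coulomb potentials *)

Arguments coulomb : simpl never.
Arguments coulomb_profile : simpl never.

Section potentials.
Context {R : realType} (m : nat).
Local Notation d := m.+1.
Implicit Types (x y z : 'rV[R]_d) (r K M L delta : R).
Implicit Types nu rho mu : probability (borel R d) R.

Lemma measurable_coulomb_shift x : measurable_fun [set: borel R d]
  (fun y : borel R d => coulomb (x - (y : 'rV[R]_d))).
Proof.
rewrite /coulomb; have me := measurable_enorm_shift x.
case: m x me => [|[|n]] x me.
- apply: measurable_funN; exact: measurable_funM.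
- apply: measurable_funN; apply: measurable_funM => //.
  exact: (measurableT_comp (@measurable_ln R)).
- apply: measurable_funM => //; apply: (measurableT_comp measurable_inv).
  exact: measurable_funX.
Qed.

Definition tame nu K M :=
  [/\ 0 <= K, 0 < M, dominated nu K & nu (~` cbox 0 M : set (borel R d)) = 0%E].

Lemma dominated_set1 nu K x : dominated nu K -> nu [set x] = 0%E.
Proof.
move=> nuK.
have xE : [set x] = [set y : borel R d | forall i,
    [set x ord0 i] ((y : 'rV[R]_d) ord0 i)].
  apply/seteqP; split=> [y -> i //|y /= yx].
  by apply/rowP => i; rewrite yx.
have mx : measurable ([set x] : set (borel R d)).
  rewrite (_ : [set x] = cbox x 0); first exact: measurable_cbox.
  apply/seteqP; split=> [y ->|y]; rewrite /cbox/=; first by rewrite subrr normr0.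
  by rewrite normr_le0 subr_eq0 => /eqP.
apply/eqP; rewrite eq_le measure_ge0 andbT (le_trans (nuK _ mx))//.
rewrite xE (@lebesgue_rV_box R d (fun i => [set x ord0 i])); last first.
  by move=> i; exact: measurable_set1.
by rewrite big_ord_recl lebesgue_measure_set1 mul0e mule0.
Qed.

Lemma dominated_box nu K z r : 0 < r -> dominated nu K ->
  (nu (box z r : set (borel R d)) <= (K * 2 ^+ d * r ^+ d)%:E)%E.
Proof.
move=> r0 nuK; rewrite (le_trans (nuK _ (measurable_box z r)))//.
by rewrite lebesgue_box// -[r *+ 2]mulr_natl exprMn -EFinM mulrA.
Qed.

(** At the origin the kernel has a conventional value that breaks monotonicity and
   the Lipschitz bound; points being null, the carrier may avoid it. *)
Lemma support_minus nu K (S : set (borel R d)) x : dominated nu K ->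
  measurable S -> nu (~` S) = 0%E ->
  measurable (S `\ x) /\ nu (~` (S `\ x)) = 0%E.
Proof.
move=> nuK mS nuS.
have mx : measurable ([set x] : set (borel R d)).
  rewrite (_ : [set x] = cbox x 0); first exact: measurable_cbox.
  apply/seteqP; split=> [y ->|y]; rewrite /cbox/=; first by rewrite subrr normr0.
  by rewrite normr_le0 subr_eq0 => /eqP.
split; first exact: measurableD.
by rewrite setDE setCI setCK null_set_setU//; [exact: measurableC|exact: dominated_set1 nuK].
Qed.

Lemma integral_riesz_tame nu K M z : tame nu K M ->
  (\int[nu]_(y in [set: borel R d]) (riesz (z - (y : 'rV[R]_d)))%:E <=
    (1 + K * 2 ^+ d * 2 ^+ d)%:E)%E.
Proof.
move=> [K0 M0 nuK _].
have := @integral_riesz_le R m nu z 1 (K * 2 ^+ d) ltr01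
  (mulr_ge0 K0 (exprn_ge0 _ (ler0n R 2))).
rewrite expr1n invr1 mulr1; apply => r r0 _; exact: dominated_box.
Qed.

Lemma integrable_riesz nu K M z : tame nu K M ->
  nu.-integrable [set: borel R d]
    (EFin \o (fun y : borel R d => riesz (z - (y : 'rV[R]_d)))).
Proof.
move=> tnu; apply/integrableP; split.
  by apply/measurable_EFinP; exact: measurable_riesz_shift.
rewrite (eq_integral (fun y : borel R d => (riesz (z - (y : 'rV[R]_d)))%:E)).
  by rewrite (le_lt_trans (integral_riesz_tame z tnu))// ltry.
by move=> y _; rewrite /= ger0_norm// riesz_ge0.
Qed.

(** On a bounded set the Lipschitz bound, used between |x - y| and 1, dominates the
   Coulomb kernel by the Riesz kernel. *)
Lemma integrable_coulomb nu K M x : tame nu K M ->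
  nu.-integrable [set: borel R d]
    (EFin \o (fun y : borel R d => coulomb (x - (y : 'rV[R]_d)))).
Proof.
move=> tnu; have [K0 M0 nuK nuM] := tnu.
have [C C0 lip] := @coulomb_profile_lipschitz R d isT.
pose A : R := d%:R * (`|x| + M).
have A0 : 0 <= A by rewrite mulr_ge0// addr_ge0// ltW.
pose c : R := `|coulomb_profile d (1 : R)| + C * (A + 1).
have c0 : 0 <= c by rewrite addr_ge0// mulr_ge0// addr_ge0.
have ir := integrable_riesz x tnu.
apply: (integrable_on_support (measurable_cbox 0 M)) => //.
  by apply/measurable_EFinP; exact: measurable_coulomb_shift.
apply: (@le_integrable _ _ _ _ _ _ _
  (EFin \o (fun y : borel R d => c * (riesz (x - (y : 'rV[R]_d)) + 1)))).
- exact: measurable_cbox.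
- by apply/measurable_EFinP/measurable_funTS; exact: measurable_coulomb_shift.
- move=> y; rewrite /cbox/= sub0r normrN => yM.
  have r0 := riesz_ge0 (x - y).
  rewrite lee_fin [leRHS]ger0_norm; last by rewrite mulr_ge0// addr_ge0.
  have [->|xy] := eqVneq (x - y) 0.
    rewrite coulombE (eqP (_ : enorm 0 == 0)) ?enorm_eq0//.
    by rewrite coulomb_profile0// normr0 mulr_ge0// addr_ge0// riesz_ge0.
  have e0 : 0 < enorm (x - y) by rewrite enorm_gt0.
  have eA : enorm (x - y) <= A.
    rewrite (le_trans (enorm_le_norm _))// ler_wpM2l//.
    by rewrite (le_trans (ler_normB _ _))// lerD2l.
  have := lip _ _ e0 ltr01; rewrite -coulombE expr1n invr1 /= -/(riesz _) => cl.
  have e1 : `|enorm (x - y) - 1| <= A + 1.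
    by rewrite (le_trans (ler_normB _ _))// normr1 lerD2r ger0_norm// ltW.
  rewrite -[coulomb _](subrK (coulomb_profile d (1 : R))).
  rewrite (le_trans (ler_normD _ _))// (le_trans (lerD cl (lexx _)))//.
  rewrite /c [leRHS]mulrDl addrC lerD//.
    by rewrite ler_peMr// lerDr.
  by rewrite ler_wpM2r ?addr_ge0// ler_wpM2l.
- have -> : EFin \o (fun y : borel R d => c * (riesz (x - (y : 'rV[R]_d)) + 1)) =
      (fun y : borel R d => c%:E *
        ((EFin \o (fun y : borel R d => riesz (x - (y : 'rV[R]_d)))) y +
         (EFin \o cst (1%R : R)) y))%E.
    by apply/funext => y /=; rewrite -EFinD -EFinM.
  apply: (integrableS measurableT) => //; first exact: measurable_cbox.
  apply: integrableZl => //; apply: integrableD => //.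
  exact: integrable_constant.
Qed.

Lemma potential_ge nu K M (S : set (borel R d)) x b : tame nu K M ->
  measurable S -> nu (~` S) = 0%E ->
  (forall y, S y -> enorm (x - y) <= b) ->
  coulomb_profile d b <= potential nu x.
Proof.
move=> tnu mS nuS Sb; have [K0 M0 nuK nuM] := tnu.
have [mSx nuSx] := support_minus x nuK mS nuS.
rewrite -[leLHS](Rintegral_constant nu).
apply: (le_Rintegral_on_support mSx nuSx).
- exact: integrable_constant.
- exact: integrable_coulomb tnu.
- move=> y [Sy xy] /=; rewrite coulombE coulomb_profile_nincr ?Sb//.
  rewrite enorm_gt0 subr_eq0; apply: contra_notN xy => /eqP -> //.
Qed.

Lemma potential_le nu K M (S : set (borel R d)) x a : tame nu K M ->
  measurable S -> nu (~` S) = 0%E -> 0 < a ->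
  (forall y, S y -> a <= enorm (x - y)) ->
  potential nu x <= coulomb_profile d a.
Proof.
move=> tnu mS nuS a0 Sa; rewrite -[leRHS](Rintegral_constant nu).
apply: (le_Rintegral_on_support mS nuS).
- exact: integrable_coulomb tnu.
- exact: integrable_constant.
- by move=> y Sy /=; rewrite coulombE coulomb_profile_nincr ?Sa.
Qed.

Definition riesz_potential nu z : R :=
  (\int[nu]_(y in [set: borel R d]) riesz (z - (y : 'rV[R]_d)))%R.

Lemma riesz_potential_le nu z b :
  (\int[nu]_(y in [set: borel R d]) (riesz (z - (y : 'rV[R]_d)))%:E <= b%:E)%E ->
  riesz_potential nu z <= b.
Proof.
move=> h; rewrite /riesz_potential /Rintegral -lee_fin fineK//.
rewrite ge0_fin_numE ?(le_lt_trans h) ?ltry//.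
by apply: integral_ge0 => y _; rewrite lee_fin riesz_ge0.
Qed.

(** This replaces the differentiation of the potential under the integral. *)
Lemma potential_lipschitz : exists2 C, 0 <= C & forall nu K M, tame nu K M ->
  forall x x', `|potential nu x - potential nu x'| <=
    C * `|x - x'| * (riesz_potential nu x + riesz_potential nu x').
Proof.
have [C C0 lip] := @coulomb_profile_lipschitz R d isT.
exists (C * d%:R); first by rewrite mulr_ge0.
move=> nu K M tnu x x'; have [K0 M0 nuK nuM] := tnu.
have ic := integrable_coulomb x tnu; have ic' := integrable_coulomb x' tnu.
have ir := integrable_riesz x tnu; have ir' := integrable_riesz x' tnu.
rewrite /potential -RintegralB//.
have icB : nu.-integrable [set: borel R d] (EFin \o
    (fun y : borel R d => coulomb (x - (y : 'rV[R]_d)) - coulomb (x' - (y : 'rV[R]_d)))).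
  exact: (integrableB measurableT ic ic').
apply: (le_trans (le_normr_Rintegral _ icB)) => //.
rewrite /riesz_potential -RintegralD// -RintegralZl//; last first.
  exact: (integrableD measurableT ir ir').
have [mS nuS] := support_minus x nuK (measurableT : measurable [set: borel R d])
  (eq_trans (f_equal nu setCT) (measure0 nu)).
have [mS' nuS'] := support_minus x' nuK mS nuS.
apply: (le_Rintegral_on_support mS' nuS').
- apply/(integrable_abse icB).
- apply: (integrableZl measurableT _ (integrableD measurableT ir ir')).
- move=> y [[_ yx] yx'] /=; rewrite !coulombE.
  have e0 : 0 < enorm (x - y).
    by rewrite enorm_gt0 subr_eq0; apply: contra_notN yx => /eqP ->.
  have e0' : 0 < enorm (x' - y).
    by rewrite enorm_gt0 subr_eq0; apply: contra_notN yx' => /eqP ->.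
  rewrite (le_trans (lip _ _ e0 e0'))// ler_wpM2r ?addr_ge0 ?riesz_ge0//.
  rewrite -mulrA ler_wpM2l// (le_trans (enorm_lipschitz _ _))//.
  by rewrite opprB addrA subrK.
Qed.

End potentials.

(** * Energy and dissipation *)

Section derivatives.
Context {R : realType} {d : nat}.
Implicit Types (f : 'rV[R]_d -> R) (x y : 'rV[R]_d) (L r : R).

Lemma norm_delta_mx_le1 (i : 'I_d) : `|delta_mx ord0 i : 'rV[R]_d| <= 1.
Proof.
apply: norm_le_coord => // j; rewrite mxE eqxx/=.
by case: eqP => _; rewrite ?normr1 ?normr0.
Qed.

(** A Lipschitz function need not be differentiable everywhere, but the limit that
   defines the derivative is 0 by convention when it does not exist. *)
Lemma partial_le_lipschitz f x i r L : 0 < r ->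
  (forall y, `|y - x| < r -> `|f y - f x| <= L * `|y - x|) ->
  `|partial i f x| <= L.
Proof.
move=> r0 fL; rewrite /partial /derive.
set F := (X in lim (X @ _)).
have L0 : 0 <= L.
  have := fL x; rewrite !subrr !normr0 mulr0 => /(_ r0) _.
  pose y := x + (r / 2) *: delta_mx ord0 i.
  have yx : y - x = (r / 2) *: delta_mx ord0 i by rewrite /y addrAC subrr add0r.
  have ny : 0 < `|y - x|.
    rewrite yx normrZ mulr_gt0 ?normr_gt0//.
      by rewrite gt_eqF// divr_gt0.
    apply/eqP => /matrixP/(_ ord0 i); rewrite !mxE !eqxx/= => /eqP.
    by rewrite oner_eq0.
  have /fL H : `|y - x| < r.
    rewrite yx normrZ gtr0_norm ?divr_gt0//.
    rewrite (@le_lt_trans _ _ (r / 2 * 1))//.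
      by rewrite ler_wpM2l ?norm_delta_mx_le1// divr_ge0// ltW.
    by rewrite mulr1 ltr_pdivrMr// ltr_pMr// ltr1n.
  by move: (le_trans (normr_ge0 _) H); rewrite pmulr_lge0.
have FL : \forall h \near (0 : R)^', `|F h| <= L.
  near=> h; have h0 : h != 0 by near: h; exact: nbhs_dnbhs_neq.
  rewrite /F /= normrZ normfV ler_pdivrMl ?normr_gt0//.
  have nh : `|h *: (delta_mx ord0 i : 'rV[R]_d)| <= `|h|.
    by rewrite normrZ ler_piMr// norm_delta_mx_le1.
  have hx : h *: delta_mx ord0 i + x - x = h *: (delta_mx ord0 i : 'rV[R]_d).
    by rewrite addrK.
  rewrite (le_trans (fL _ _))// hx.
    rewrite (le_lt_trans nh)//; near: h; exact: dnbhs0_lt.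
  by rewrite mulrC ler_wpM2r.
have [cF|dF] := pselect (cvg (F @ (0 : R)^')).
  rewrite ler_norml; apply/andP; split.
    apply: limr_ge => //; apply: filterS FL => h; rewrite ler_norml.
    by case/andP.
  apply: limr_le => //; apply: filterS FL => h; rewrite ler_norml.
  by case/andP.
by rewrite (dvgP dF) (_ : point = 0 :> R)// normr0.
Unshelve. all: by end_near. Qed.

Lemma sqr_enorm_grad_le f x L : 0 <= L ->
  (forall i, `|partial i f x| <= L) -> enorm (grad f x) ^+ 2 <= d%:R * L ^+ 2.
Proof.
move=> L0 fL; rewrite sqr_enorm (@le_trans _ _ (\sum_(i < d) L ^+ 2))//.
  apply: ler_sum => i _; rewrite mxE -real_normK ?num_real//.
  by rewrite lerXn2r// ?nnegrE.
by rewrite sumr_const card_ord mulr_natl.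
Qed.

End derivatives.

Section energy_and_dissipation.
Context {R : realType} (m : nat).
Local Notation d := m.+1.
Implicit Types (x y z : 'rV[R]_d) (r K M L delta : R).
Variables (rho mu : probability (borel R d) R) (Kr Mr Km Mm : R).
Hypotheses (trho : tame rho Kr Mr) (tmu : tame mu Km Mm).
Local Notation u := (potential_diff rho mu).

Lemma potential_diff_lipschitz :
  exists L, forall x y, `|u x - u y| <= L * `|x - y|.
Proof.
have [C C0 lip] := @potential_lipschitz R m.
pose b K : R := 1 + K * 2 ^+ d * 2 ^+ d.
exists (C * (b Kr + b Kr) + C * (b Km + b Km)) => x y.
have H nu K M : tame nu K M ->
    `|potential nu x - potential nu y| <= C * (b K + b K) * `|x - y|.
  move=> tnu; rewrite (le_trans (lip nu K M tnu x y))// mulrAC.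
  rewrite ler_wpM2r// ler_wpM2l// lerD//.
    exact/riesz_potential_le/(integral_riesz_tame x tnu).
  exact/riesz_potential_le/(integral_riesz_tame y tnu).
rewrite mulrDl /potential_diff opprD addrACA.
rewrite (le_trans (ler_normD _ _))// -[X in _ + `|X|]opprD normrN.
by rewrite lerD ?(H _ _ _ trho) ?(H _ _ _ tmu).
Qed.

Lemma integrable_potential_diff nu K M : tame nu K M ->
  nu.-integrable [set: borel R d] (EFin \o (u : borel R d -> R)).
Proof.
move=> [K0 M0 nuK nuM]; have [L lip] := potential_diff_lipschitz.
apply: (@integrable_bounded _ _ _ _ _ _ (`|u 0| + `|L| * M)
  (measurable_cbox 0 M) nuM).
  by apply: continuous_measurable_borel; exact: lipschitz_continuous lip.
move=> x; rewrite /cbox/= sub0r normrN => xM.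
rewrite -[u x](subrK (u 0)) addrC (le_trans (ler_normD _ _))// lerD2l.
rewrite (le_trans (lip _ _))// subr0.
by rewrite (le_trans (ler_wpM2r _ (ler_norm L)))// ler_wpM2l.
Qed.

(** Since the kernel is radially decreasing, pointwise bounds on the potentials
   over the two supports suffice. *)
Lemma MMD2_ge (S T : set (borel R d)) (a b c : R) :
  measurable S -> measurable T -> rho (~` S) = 0%E -> mu (~` T) = 0%E -> 0 < c ->
  (forall x y, S x -> S y -> enorm (x - y) <= a) ->
  (forall x y, T x -> T y -> enorm (x - y) <= b) ->
  (forall x y, S x -> T y -> c <= enorm (x - y)) ->
  2^-1 * (coulomb_profile d a + coulomb_profile d b - 2 * coulomb_profile d c)
    <= MMD2 rho mu.
Proof.
move=> mS mT rhoS muT c0 Sa Tb STc; rewrite /MMD2 ler_wpM2l//.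
have TSc x y : T x -> S y -> c <= enorm (x - y).
  by move=> Tx Sy; rewrite -opprB -scaleN1r enormZ normrN1 mul1r STc.
have lo : coulomb_profile d a - coulomb_profile d c <=
    (\int[rho]_(x in [set: borel R d]) u x)%R.
  rewrite -[leLHS](Rintegral_constant rho).
  apply: (le_Rintegral_on_support mS rhoS).
  - exact: integrable_constant.
  - exact: integrable_potential_diff trho.
  - move=> x Sx /=; rewrite lerB//.
      exact: (potential_ge trho mS rhoS (fun y => Sa x y Sx)).
    exact: (potential_le tmu mT muT c0 (fun y => STc x y Sx)).
have hi : (\int[mu]_(x in [set: borel R d]) u x)%R <=
    coulomb_profile d c - coulomb_profile d b.
  rewrite -[leRHS](Rintegral_constant mu).
  apply: (le_Rintegral_on_support mT muT).
  - exact: integrable_potential_diff tmu.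
  - exact: integrable_constant.
  - move=> x Tx /=; rewrite lerB//.
      exact: (potential_le trho mS rhoS c0 (fun y => TSc x y Tx)).
    exact: (potential_ge tmu mT muT (fun y => Tb x y Tx)).
by move: lo hi; set I := Rintegral _ _ _; set J := Rintegral _ _ _; lra.
Qed.

End energy_and_dissipation.

(** The local Lipschitz constant of each potential near the support of the first
   measure bounds the field there. *)
Lemma dissipation_le {R : realType} (m : nat) : exists2 C : R, 0 <= C &
  forall (rho mu : probability (borel R m.+1) R) (Kr Mr Km Mm : R),
  tame rho Kr Mr -> tame mu Km Mm ->
  forall (S : set (borel R m.+1)) (b r : R), measurable S ->
  rho (~` S) = 0%E -> 0 <= b -> 0 < r ->
  (forall x y, S x -> `|y - x| < r ->
     riesz_potential rho y + riesz_potential mu y <= b) ->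
  (dissipation rho mu <= (C * b ^+ 2)%:E)%E.
Proof.
have [C C0 lip] := @potential_lipschitz R m.
exists (m.+1%:R * (2 * C) ^+ 2); first by rewrite mulr_ge0// sqr_ge0.
move=> rho mu Kr Mr Km Mm trho tmu S b r mS rhoS b0 r0 Sb.
apply: (integral_le_on_support mS rhoS).
- by move=> x; rewrite lee_fin sqr_ge0.
- move=> x Sx; rewrite lee_fin -mulrA -exprMn.
  apply: sqr_enorm_grad_le => [|i]; first by rewrite !mulr_ge0.
  apply: (partial_le_lipschitz i r0) => y yr.
  rewrite /potential_diff opprD addrACA (le_trans (ler_normD _ _))//.
  rewrite -[X in _ + `|X|]opprD normrN.
  rewrite (le_trans (lerD (lip _ _ _ trho y x) (lip _ _ _ tmu y x)))//.
  have := Sb x x Sx; rewrite subrr normr0 => /(_ r0) xb.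
  have yb := Sb x y Sx yr.
  rewrite (_ : 2 * C * b * _ = C * `|y - x| * (2 * b)); last by ring.
  by rewrite -mulrDr ler_wpM2l ?mulr_ge0//; lra.
- by rewrite !mulr_ge0// sqr_ge0.
Qed.

(** * Densities spread over a large cube *)

Section compact_boxes.
Context {R : realType} {d : nat}.

Lemma closed_cbox (z : 'rV[R]_d) (r : R) : closed (cbox z r).
Proof. exact: closed_closed_ball_. Qed.

Lemma compact_cbox (r : R) : compact (cbox (0 : 'rV[R]_d) r).
Proof.
apply: bounded_closed_compact; last exact: closed_cbox.
exists r; split; first exact: num_real.
by move=> t rt x; rewrite /cbox/= sub0r normrN => /le_trans; apply; exact: ltW.
Qed.

End compact_boxes.

Section spread_density.
Context {R : realType} (m : nat).
Local Notation d := m.+1.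
Implicit Types (x y z : 'rV[R]_d) (s c : R).

Definition scaled_bump s x : R := \prod_(i < d) bump (s^-1 * x ord0 i).

(** The normalizing constant is absorbed into one of the factors. *)
Lemma scaled_bumpE s c : (fun x => c * scaled_bump s x) =
  tensor (fun (i : 'I_d) t => (if i == ord0 then c else 1) * bump (s^-1 * t)).
Proof.
apply/funext => x; rewrite /tensor big_split/=; congr (_ * _).
by rewrite big_ord_recl eqxx big1 ?mulr1.
Qed.

Lemma smooth_scaled_bump s c : smooth (fun x => c * scaled_bump s x).
Proof.
rewrite scaled_bumpE; apply: smooth_tensor => i k.
exact/differentiable_uptoZ/smooth_bump_scale.
Qed.

Lemma scaled_bump_ge0 s x : 0 <= scaled_bump s x.
Proof. by apply: prodr_ge0 => i _; exact: bump_ge0. Qed.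

Lemma scaled_bump_le1 s x : scaled_bump s x <= 1.
Proof. by apply: prodr_ile1 => i _; rewrite bump_ge0 bump_le1. Qed.

Definition bump_center s : 'rV[R]_d := \row_i (7 / 2 * s).

Lemma scaled_bump_neq0 s x : 0 < s -> scaled_bump s x != 0 ->
  box (bump_center s) (s / 2) x.
Proof.
move=> s0 /prodf_neq0 nz; rewrite /box/= norm_lt_coord ?divr_gt0//.
apply/forallP => i; rewrite !mxE.
have /bump_neq0 /andP[] := nz i isT.
by rewrite mulrC ltr_pdivlMr// ltr_pdivrMr// ltr_norml => *; lra.
Qed.

Lemma box_bump_center s : 0 < s -> box (bump_center s) (s / 2) `<=` cbox 0 (4 * s).
Proof.
move=> s0 x; rewrite /box/cbox/= sub0r normrN norm_lt_coord ?divr_gt0//.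
move=> /forallP bx; apply: norm_le_coord => [|i]; first by rewrite mulr_ge0// ltW.
have := bx i; rewrite !mxE ltr_norml => /andP[*]; rewrite ler_norml; lra.
Qed.

Lemma scaled_bump_ge s x : 0 < s -> box (bump_center s) (s / 6) x ->
  expR (- 6) ^+ d <= scaled_bump s x.
Proof.
move=> s0; rewrite /box/= norm_lt_coord ?divr_gt0// => /forallP bx.
rewrite -[X in _ ^+ X]card_ord -prodr_const; apply: ler_prod => i _.
rewrite expR_ge0 bump_ge// [s^-1 * _]mulrC ler_pdivlMr// ler_pdivrMr//.
by have := bx i; rewrite !mxE ltr_norml => /andP[*]; lra.
Qed.

Lemma measurable_scaled_bump s c :
  measurable_fun [set: borel R d] ((fun x => c * scaled_bump s x) : borel R d -> R).
Proof.
apply: continuous_measurable_borel.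
by have [] := smooth_scaled_bump s c 0.
Qed.

Lemma Cc_infty_scaled_bump s c : 0 < s -> Cc_infty (fun x => c * scaled_bump s x).
Proof.
move=> s0; split; first exact: smooth_scaled_bump.
apply: (@subclosed_compact _ _ (cbox 0 (4 * s))); first exact: closed_closure.
  exact: compact_cbox.
rewrite [X in _ `<=` X](closure_id _).1; last exact: closed_cbox.
apply: closureS => x /=; rewrite mulf_eq0 negb_or => /andP[_ bx].
exact: box_bump_center (scaled_bump_neq0 s0 bx).
Qed.

End spread_density.

Section spread_probability.
Context {R : realType} (m : nat).
Local Notation d := m.+1.
Implicit Types (x y z : 'rV[R]_d) (s c : R).

Lemma integral_scaled_bump_ge s : 0 < s ->
  ((expR (- 6) ^+ d * (s / 3) ^+ d)%:E <=
    \int[lebesgue_rV (d:=d)]_(x in [set: borel R d]) (scaled_bump s x)%:E)%E.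
Proof.
move=> s0; pose B : set (borel R d) := box (bump_center m s) (s / 6).
have mB : measurable B by exact: measurable_box.
apply: (@le_trans _ _ (\int[lebesgue_rV (d:=d)]_(x in [set: borel R d])
    (expR (- 6) ^+ d * \1_B x)%:E)%E).
  rewrite (integralZl_indic _ (fun=> B))//; last first.
    by move=> neg; move: (exprn_ge0 d (expR_ge0 (- 6 : R))); rewrite leNgt neg.
  rewrite integral_indic// setIT.
  rewrite [X in (_ * X)%E](_ : _ = ((s / 6 *+ 2) ^+ d)%:E); last first.
    by apply: lebesgue_box; rewrite divr_gt0.
  rewrite -EFinM lee_fin.
  rewrite ler_wpM2l ?exprn_ge0 ?expR_ge0// le_eqVlt; apply/orP; left; apply/eqP.
  by congr (_ ^+ _); lra.
apply: ge0_le_integral_any => x.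
  by rewrite lee_fin mulr_ge0// exprn_ge0// expR_ge0.
rewrite lee_fin indicE; case: (boolP (x \in B)) => [|_]; last by rewrite mulr0 scaled_bump_ge0.
by rewrite inE mulr1 => Bx; exact: scaled_bump_ge Bx.
Qed.

Lemma integral_scaled_bump_lty s : 0 < s ->
  (\int[lebesgue_rV (d:=d)]_(x in [set: borel R d]) (scaled_bump s x)%:E < +oo)%E.
Proof.
move=> s0; pose B : set (borel R d) := box (bump_center m s) (s / 2).
have mB : measurable B by exact: measurable_box.
apply: (@le_lt_trans _ _ (\int[lebesgue_rV (d:=d)]_(x in [set: borel R d])
    (\1_B x)%:E)%E).
  apply: ge0_le_integral_any => x; first by rewrite lee_fin scaled_bump_ge0.
  rewrite lee_fin indicE; case: (boolP (x \in B)) => [_|xB]; first exact: scaled_bump_le1.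
  rewrite leNgt; apply: contra xB => fx.
  exact/mem_set/(scaled_bump_neq0 s0 (lt0r_neq0 fx)).
rewrite integral_indic// setIT.
rewrite [X in (X < _)%E](_ : _ = ((s / 2 *+ 2) ^+ d)%:E) ?ltry//.
by apply: lebesgue_box; rewrite divr_gt0.
Qed.

(** The bump is bounded below on a smaller box, so its mass is at least of order s^d,
   while its maximum is at most 1: normalizing makes the density O(s^(-d)). *)
Lemma spread_probability : exists2 C : R, 0 <= C & forall s, 0 < s ->
  exists rho : probability (borel R d) R,
  [/\ Cc_infty_density rho, dominated rho (C * s ^- d) &
      rho (~` box (bump_center m s) (s / 2) : set (borel R d)) = 0%E].
Proof.
pose k : R := expR (- 6) ^+ d * 3^-1 ^+ d.
have k0 : 0 < k by rewrite mulr_gt0// exprn_gt0// ?expR_gt0// invr_gt0.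
exists k^-1 => [|s s0]; first by rewrite invr_ge0 ltW.
set C := (\int[lebesgue_rV (d:=d)]_(x in [set: borel R d]) (scaled_bump s x)%:E)%E.
have Cge : ((k * s ^+ d)%:E <= C)%E.
  have := @integral_scaled_bump_ge s s0; apply: le_trans.
  by rewrite lee_fin /k exprMn mulrA mulrAC.
have Clty : (C < +oo)%E by exact: integral_scaled_bump_lty.
have ksd : 0 < k * s ^+ d by rewrite mulr_gt0// exprn_gt0.
have C0 : (0 < C)%E by rewrite (lt_le_trans _ Cge)// lte_fin.
have Cfin : C \is a fin_num by rewrite ge0_fin_numE// ltW.
pose c := (fine C)^-1.
have c0 : 0 < c by rewrite invr_gt0 fine_gt0// C0 Clty.
have mf := @measurable_scaled_bump R m s c.
have f0 x : 0 <= c * scaled_bump s x by rewrite mulr_ge0 ?scaled_bump_ge0// ltW.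
have f1 : (\int[lebesgue_rV (d:=d)]_(x in [set: borel R d]) (c * scaled_bump s x)%:E = 1)%E.
  under eq_integral do rewrite EFinM.
  rewrite ge0_integralZl//=; last 3 first.
  - apply/measurable_EFinP; have := @measurable_scaled_bump R m s 1.
    by under eq_fun do rewrite mul1r.
  - by move=> x _; rewrite lee_fin scaled_bump_ge0.
  - by rewrite lee_fin ltW.
  rewrite -/C -[X in (_ * X)%E](fineK Cfin) -EFinM /c mulVf// gt_eqF//.
  by rewrite -invr_gt0.
have [rho rhoE] := exists_probability_with_density mf f0 f1.
have rhof : has_density rho (fun x => c * scaled_bump s x).
  by move=> A mA; exact: rhoE.
exists rho; split.
- by exists (fun x => c * scaled_bump s x) => //; exact: Cc_infty_scaled_bump.
- apply: dominated_density rhof => //.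
  + by rewrite mulr_ge0 ?invr_ge0 ?exprn_ge0// ltW.
  + apply: aeW => x /=; rewrite ger0_norm// (@le_trans _ _ c)//.
      by rewrite ler_piMr ?scaled_bump_le1// ltW.
    rewrite -invfM /c lef_pV2 ?posrE ?fine_gt0 ?C0//.
    by rewrite -lee_fin fineK.
- rewrite rhof; last by apply: measurableC; exact: measurable_box.
  rewrite integral0_eq// => x nx; congr EFin.
  have [->|/(scaled_bump_neq0 s0)//] := eqVneq (scaled_bump s x) 0.
  by rewrite mulr0.
Qed.

End spread_probability.

(** * The estimates for a spread measure far from mu *)

Section far_spread.
Context {R : realType} (m : nat).
Local Notation d := m.+1.

Lemma bump_center_gt (s : R) (x : 'rV[R]_d) i : 0 < s ->
  box (bump_center m s) (s / 2) x -> 3 * s < x ord0 i.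
Proof.
move=> s0; rewrite /box/= norm_lt_coord ?divr_gt0// => /forallP/(_ i).
by rewrite !mxE ltr_norml => /andP[*]; lra.
Qed.

(** M bounds the support of mu, so for s >= M the two supports are at distance at
   least 2 s, and the boxes of half-side s around the points near the support of rho
   do not meet the support of mu. *)
Lemma spread_estimates (mu : probability (borel R d) R) (K M : R) :
  tame mu K M -> exists2 B : R, 0 <= B & forall s : R, M <= s ->
  exists rho : probability (borel R d) R,
  [/\ Cc_infty_density rho, 2^-1 * energy_gap d M s <= MMD2 rho mu &
      (dissipation rho mu <= (B * (s ^- m) ^+ 2)%:E)%E].
Proof.
move=> tmu; have [K0 M0 muK muM] := tmu.
have [C0 C0_ge0 spread] := @spread_probability R m.
have [C1 C1_ge0 diss] := @dissipation_le R m.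
pose b : R := 2 + C0 * 2 ^+ d * 2 ^+ d.
have b0 : 0 <= b by rewrite addr_ge0// !mulr_ge0.
exists (C1 * b ^+ 2) => [|s Ms]; first by rewrite mulr_ge0// sqr_ge0.
have s0 : 0 < s by exact: lt_le_trans Ms.
have [rho [smooth_rho rhoK rhoS]] := spread s s0.
pose S : set (borel R d) := box (bump_center m s) (s / 2).
have mS : measurable S by exact: measurable_box.
have mT : measurable (cbox 0 M : set (borel R d)) by exact: measurable_cbox.
have trho : tame rho (C0 * s ^- d) (4 * s).
  split=> //; [|by rewrite mulr_gt0|].
    by rewrite mulr_ge0// invr_ge0 exprn_ge0// ltW.
  apply/eqP; rewrite eq_le measure_ge0 andbT -rhoS le_measure ?inE//.
  - by apply: measurableC; exact: measurable_cbox.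
  - exact: measurableC.
  - by apply: subsetC; exact: box_bump_center.
exists rho; split=> //.
- apply: (MMD2_ge trho tmu mS mT rhoS muM) => [|x y Sx Sy|x y Tx Ty|x y Sx Ty].
  + by rewrite mulr_gt0.
  + rewrite (le_trans (enorm_le_norm _))// ler_wpM2l//.
    have -> : x - y = (bump_center m s - y) - (bump_center m s - x).
      by rewrite opprB [RHS]addrC addrA subrK.
    rewrite (le_trans (ler_normB _ _))//.
    have xs : `|bump_center m s - x| < s / 2 := Sx.
    have ys : `|bump_center m s - y| < s / 2 := Sy.
    lra.
  + rewrite (le_trans (enorm_le_norm _))// [2 * _]mulrC -mulrA ler_wpM2l//.
    rewrite (le_trans (ler_normB _ _))//.
    by move: Tx Ty; rewrite /cbox/= !sub0r !normrN; lra.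
  + rewrite (le_trans _ (coord_le_enorm _ ord0))// !mxE.
    have xs := bump_center_gt ord0 s0 Sx.
    have := le_trans (coord_le_norm y ord0) (_ : `|y| <= M).
    move: Ty; rewrite /cbox/= sub0r normrN => yM /(_ yM).
    rewrite ler_norml => /andP[_ yM'].
    by rewrite (le_trans _ (ler_norm _))//; lra.
- have -> : C1 * b ^+ 2 * (s ^- m) ^+ 2 = C1 * (s ^- m * b) ^+ 2.
    by rewrite exprMn; ring.
  apply: (diss rho mu _ _ _ _ trho tmu S _ (s / 2) mS rhoS).
  + by rewrite mulr_ge0// invr_ge0 exprn_ge0// ltW.
  + by rewrite divr_gt0.
  + move=> x y Sx yx.
    (* The two summands are the shell bounds for rho and for mu, both with r = s. *)
    have -> : s ^- m * b = (s ^- m + C0 * s ^- d * 2 ^+ d * 2 ^+ d * s) +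
        (s ^- m + 0 * 2 ^+ d * s).
      rewrite /b (exprS s m); field; rewrite !gt_eqF//.
      exact: exprn_gt0.
    have s_gt0 := s0.
    apply: lerD.
      apply: riesz_potential_le; apply: integral_riesz_le => //.
        by rewrite !mulr_ge0// invr_ge0 exprn_ge0// ltW.
      by move=> r r0 _; exact: dominated_box.
    apply: riesz_potential_le; apply: integral_riesz_le => // r r0 rs.
    rewrite mul0r [leRHS](_ : _ = mu (~` cbox 0 M)); last by rewrite muM.
    apply: le_measure; rewrite ?inE.
    * exact: measurable_box.
    * exact: measurableC.
    * move=> w yw Tw.
      have xs := bump_center_gt ord0 s0 Sx.
      have := le_lt_trans (coord_le_norm (y - w) ord0) yw.
      have := le_lt_trans (coord_le_norm (y - x) ord0) yx.
      have : `|w ord0 ord0| <= M.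
        rewrite (le_trans (coord_le_norm _ _))//.
        by move: Tw; rewrite /cbox/= sub0r normrN.
      rewrite !mxE !ltr_norml ler_norml => /andP[_ w1] /andP[y1 _] /andP[_ y2].
      lra.
Qed.

End far_spread.

Lemma tame_of_Linfty (R : realType) (m : nat) (mu : probability (borel R m.+1) R) :
  Linfty_density mu -> compactly_supported mu -> exists K M, tame mu K M.
Proof.
move=> /dominated_Linfty[K K0 muK] [A cA muA].
have [N [_ AN]] := compact_bounded cA.
pose M := `|N| + 1; exists K, M.
have M0 : 0 < M by rewrite ltr_wpDl.
split=> //; apply/eqP; rewrite eq_le measure_ge0 andbT -muA.
apply: le_measure; rewrite ?inE.
- by apply: measurableC; exact: measurable_cbox.
- apply: open_measurable_borel; apply: closed_openC.
  exact: (compact_closed (@norm_hausdorff _ _) cA).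
- apply: subsetC => x Ax; rewrite /cbox/= sub0r normrN.
  by apply: (AN M) => //; rewrite (le_lt_trans (ler_norm N))// ltrDl.
Qed.

Theorem proposition1p19 (R : realType) (d : nat) (d_ge1 : (1 <= d)%N)
    (mu : probability (borel R d) R)
    (mu_Linfty : Linfty_density mu) (mu_cs : compactly_supported mu) :
  (exists rho : nat -> probability (borel R d) R,
    [/\ forall n, Cc_infty_density (rho n),
        forall n, 0 < MMD2 (rho n) mu &
        (dissipation (rho n) mu / (MMD2 (rho n) mu)%:E)%E
          @[n --> \oo] --> 0%:E]) /\
  ~ (exists C : R, forall rho : probability (borel R d) R,
       Cc_infty_density rho ->
       ((MMD2 rho mu)%:E <= C%:E * dissipation rho mu)%E).
Proof.
(* Both claims follow from ratios that are arbitrarily small. *)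
have small e : 0 < e -> exists rho : probability (borel R d) R,
    [/\ Cc_infty_density rho, 0 < MMD2 rho mu &
        (dissipation rho mu <= (e * MMD2 rho mu)%:E)%E].
  move=> e0; case: d d_ge1 mu mu_Linfty mu_cs => // m _ nu nu_Linfty nu_cs.
  have [K [M tnu]] := tame_of_Linfty nu_Linfty nu_cs.
  have [B B0 spread] := spread_estimates tnu.
  have [K0 M0 nuK nuM] := tnu.
  have e2 : 0 < e / 2 by rewrite divr_gt0.
  have [s0 hs] := energy_gap_dominates (isT : (0 < m.+1)%N) M0 B0 e2.
  pose s := Num.max s0 M.
  have [] := hs s; first by rewrite le_max lexx.
  move=> s_gt0 gap0 gapB; have [|rho [? gapM rhoB]] := spread s.
    by rewrite le_max lexx orbT.
  exists rho; split=> //.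
    by rewrite (lt_le_trans _ gapM)// mulr_gt0.
  rewrite (le_trans rhoB)// lee_fin (le_trans gapB)//.
  by rewrite -mulrA ler_wpM2l// ltW.
have diss0 rho : (0 <= dissipation rho mu)%E.
  by apply: integral_ge0 => x _; rewrite lee_fin sqr_ge0.
split; last first.
  move=> [C hC].
  (* C may be negative, hence the absolute value. *)
  have C1 : 0 < `|C| + 1 by rewrite ltr_wpDl.
  have [|rho [rhoS M0 De]] := small ((`|C| + 1)^-1 / 2).
    by rewrite divr_gt0// invr_gt0.
  have := hC rho rhoS; apply/negP; rewrite -ltNge.
  rewrite (@le_lt_trans _ _ ((`|C| + 1)%:E * dissipation rho mu)%E)//.
    rewrite lee_wpmul2r// lee_fin (le_trans (ler_norm _))// lerDl//.
  rewrite (@le_lt_trans _ _ ((`|C| + 1)%:E * ((`|C| + 1)^-1 / 2 * MMD2 rho mu)%:E)%E)//.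
    by rewrite lee_wpmul2l// lee_fin ltW.
  rewrite -EFinM lte_fin mulrA [X in X * _]mulrA divff ?gt_eqF// mul1r.
  by rewrite gtr_pMl// invf_lt1// ltr1n.
have harm n : 0 < (n.+1%:R^-1 : R) by rewrite invr_gt0.
have [rho rhoP] := choice (fun n : nat => small _ (harm n)).
exists rho; split=> [n|n|]; [by case: (rhoP n)|by case: (rhoP n)|].
apply: (@squeeze_cvge _ _ _ _ (cst 0%E) _ (fun n => (n.+1%:R^-1)%:E)).
- apply: nearW => n; have [_ M0 De] := rhoP n.
  rewrite inver gt_eqF// /=; apply/andP; split.
    by rewrite mule_ge0// lee_fin invr_ge0 ltW.
  by rewrite lee_pdivrMr//; rewrite -EFinM.
- exact: cvg_cst.
- exact: cvge_harmonic.
Qed.
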